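(* Let $b_1=\begin{pmatrix}0&1\\t&0\end{pmatrix}$ and let $w\in W_a$ be such that $X_w(b_1)\neq\emptyset$. Then $$X^{SL_2}_w(b_1)\cong\mathbb A_k^{\frac{\ell(w)}2}$$ as $k$-varieties. Further, $$X_w(b_1)\cong\coprod_{J_{b_1}/H_{b_1}}\mathbb A_k^{\frac{\ell(w)}2}$$ as $k$-varieties, and $J_{b_1}$ acts on the set of these connected components by left multiplication on the index set.
   Context: $k$ is a field with $q$ elements, $\bar k$ an algebraic closure, $F=k((t))$, $L=\bar k((t))$, $\mathfrak{o}=\bar k[[t]]$, $\mathfrak p=t\mathfrak o$, $v_L$ the $t$-adic valuation of $L$; $\sigma(\sum a_nt^n)=\sum a_n^q t^n$ is the Frobenius of $L/F$, applied entrywise to matrices. $T\subset GL_2$ is the diagonal torus, $T^{SL_2}=T\cap SL_2$, $I=\begin{pmatrix}\mathfrak o^\times&\mathfrak o\\ \mathfrak p&\mathfrak o^\times\end{pmatrix}\subset GL_2(L)$, $I^{SL_2}=I\cap SL_2(L)$. $W_a=N_{SL_2}(T^{SL_2})(L)/T^{SL_2}(\mathfrak o)$. Its elements are the classes of $\begin{pmatrix}t^{-s}&0\\0&t^s\end{pmatrix}$ and $\begin{pmatrix}0&t^{-s}\\-t^s&0\end{pmatrix}$, $s\in\mathbb Z$; the length is $\ell(w)=|2s|$, resp. $|2s-1|$. $\tilde W=N_{GL_2}(T)(L)/T(\mathfrak o)=W_a\rtimes\mathbb Z$, where $(w,v)$ is the class of $wb_1^v$. $X_w(b_1)$ is non-empty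 if and only if $\ell(w)$ is even. Affine space of dimension zero is a point. The affine flag manifolds $X^{SL_2}$ and $X$ of $SL_2$ and $GL_2$ are Ind-schemes over $k$ with $X^{SL_2}(\bar k)=SL_2(L)/I^{SL_2}$, $X(\bar k)=GL_2(L)/I$ (parametrizing chains of lattices $t\mathfrak L_1\subsetneq\mathfrak L_0\subsetneq\mathfrak L_1$ with $\mathfrak L_0/t\mathfrak L_1$ of rank one, where for $SL_2$ moreover $\wedge^2\mathfrak L_0$ is fixed to be the $\wedge^2$ of the base chain). For $b\in GL_2(L)$, $w\in W_a$ put $\tilde w=(w,v_L(\det b))$ and $$X_w(b)=\{xI\in GL_2(L)/I:x^{-1}b\sigma(x)\in I\tilde wI\},\qquad X^{SL_2}_w(b)=\{xI^{SL_2}\in SL_2(L)/I^{SL_2}:x^{-1}b\sigma(x)\in I\tilde wI\},$$ locally closed subsets with the reduced structure. $J_b=\{g\in GL_2(L):g^{-1}b\sigma(g)=b\}$ acts on $X_w(b)$ by left multiplication, and $H_b=\ker(v_L\circ\det:J_b\to\mathbb Z)$. *)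

(* Defs.v *)
From HB Require Import structures.
From mathcomp Require Import all_boot all_order all_algebra.
From mathcomp Require Import boolp classical_sets functions fsbigop.
From mathcomp Require Import zify.
From mathcomp Require mpoly.
Set Implicit Arguments. Unset Strict Implicit. Unset Printing Implicit Defensive.
Import Order.TTheory GRing.Theory Num.Theory.
Local Open Scope classical_set_scope.
Local Open Scope ring_scope.

Section Laurent.
Variable K : fieldType.

Definition vanishes_below (a : int) (f : int -> K) : Prop :=
  forall n : int, n < a -> f n = 0.

Definition laurent_pred : {pred int -> K} :=
  fun f => `[< exists a, vanishes_below a f >].

(* laurent is K((t)): lcoef f n is the coefficient of t^n. *)
Record laurent := Laurent {
  lcoef :> int -> K;
  laurentP : lcoef \in laurent_pred }.

HB.instance Definition _ := [isSub for lcoef].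
HB.instance Definition _ := [Choice of laurent by <:].

Lemma vanishes_below_le a b f :
  a <= b -> vanishes_below b f -> vanishes_below a f.
Proof. by move=> ab vf n na; apply: vf; apply: lt_le_trans ab. Qed.

Lemma laurent_predP f :
  reflect (exists a, vanishes_below a f) (f \in laurent_pred).
Proof. exact: asboolP. Qed.

Fact laurent_zmod_closed : zmod_closed laurent_pred.
Proof.
split; first by apply/laurent_predP; exists 0.
move=> f g /laurent_predP[a fa] /laurent_predP[b gb].
apply/laurent_predP; exists (Order.min a b) => n; rewrite lt_min => /andP[na nb].
by rewrite !fctE fa ?gb ?subr0.
Qed.
HB.instance Definition _ :=
  GRing.isZmodClosed.Build (int -> K) laurent_pred laurent_zmod_closed.
HB.instance Definition _ := [SubChoice_isSubZmodule of laurent by <:].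

Lemma laurent_eqP (f g : laurent) : (forall n, f n = g n) -> f = g.
Proof. by move=> fg; apply/val_inj/funext. Qed.

Lemma laurent_bound (f : laurent) : exists a, vanishes_below a f.
Proof. exact/laurent_predP/laurentP. Qed.

Lemma laurent_bound2 (f g : laurent) :
  exists a, vanishes_below a f /\ vanishes_below a g.
Proof.
have [a fa] := laurent_bound f; have [b gb] := laurent_bound g.
exists (Order.min a b); split.
- by apply: vanishes_below_le fa; rewrite ge_min lexx.
- by apply: vanishes_below_le gb; rewrite ge_min lexx orbT.
Qed.

(* The Cauchy product; the sum has finitely many nonzero terms. *)
Definition conv (f g : int -> K) (n : int) : K :=
  \sum_(i \in [set: int]) f i * g (n - i).

Lemma conv_nat a b f g (m : nat) :
    vanishes_below a f -> vanishes_below b g ->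
  conv f g (a + b + m%:Z) = \sum_(i < m.+1) f (a + i%:Z) * g (b + (m - i)%N%:Z).
Proof.
move=> fa gb; rewrite /conv -(fsbig_widen [set i : int | a <= i <= a + m%:Z]) //; last first.
  move=> i [_ /= /negP]; rewrite negb_and -!ltNge => /orP[ia|ia] /=.
    by rewrite fa ?mul0r.
  by rewrite gb ?mulr0 //; lia.
rewrite (fsbig_fwiden [seq a + j%:Z | j <- iota 0 m.+1]).
- rewrite big_map -[iota 0 _]/(index_iota 0 m.+1) big_mkord.
  apply: eq_bigr => i _; congr (_ * g _); have := ltn_ord i; lia.
- move=> i /= /andP[ai im]; change (i \in [seq a + j%:Z | j <- iota 0 m.+1]); apply/mapP; exists `|i - a|%N; last by lia.
  by rewrite mem_iota; lia.
- by rewrite map_inj_uniq ?iota_uniq // => i j; lia.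
- move=> i [ir /= nai]; exfalso; apply: nai.
  have /mapP[j] : i \in [seq a + j%:Z | j <- iota 0 m.+1] by [].
  by rewrite mem_iota => jm ->; lia.
Qed.

Lemma conv_below a b f g :
  vanishes_below a f -> vanishes_below b g -> vanishes_below (a + b) (conv f g).
Proof.
move=> fa gb n nab; rewrite /conv fsbig1 // => i _.
have [ia|ai] := ltP i a; first by rewrite fa ?mul0r.
by rewrite gb ?mulr0 //; lia.
Qed.

Fact conv_laurent (f g : laurent) : conv f g \in laurent_pred.
Proof.
have [a fa] := laurent_bound f; have [b gb] := laurent_bound g.
by apply/laurent_predP; exists (a + b); apply: conv_below.
Qed.

Definition lmul (f g : laurent) : laurent := Laurent (conv_laurent f g).

(* c t^m *)
Definition mono_fun (c : K) (m n : int) : K := if n == m then c else 0.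

Lemma mono_below c m : vanishes_below m (mono_fun c m).
Proof. by move=> n nm; rewrite /mono_fun lt_eqF. Qed.

Fact mono_laurent c m : mono_fun c m \in laurent_pred.
Proof. by apply/laurent_predP; exists m; apply: mono_below. Qed.

Definition mono (c : K) (m : int) : laurent := Laurent (mono_laurent c m).

Definition lone : laurent := mono 1 0.

Let trunc M a (f : int -> K) : {poly K} := \poly_(i < M) f (a + i%:Z).

Let conv_poly a b f g (m M : nat) :
    vanishes_below a f -> vanishes_below b g -> (m < M)%N ->
  conv f g (a + b + m%:Z) = (trunc M a f * trunc M b g)`_m.
Proof.
move=> fa gb mM; rewrite conv_nat // coefM; apply: eq_bigr => i _.
rewrite !coef_poly !ifT //; first by apply: leq_ltn_trans mM; exact: leq_subr.
by apply: leq_ltn_trans mM; rewrite -ltnS.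
Qed.

Let eq_trunc M a b f g (P : {poly K}) :
    vanishes_below a f -> vanishes_below b g ->
  {in gtn M, forall m : nat,
    (trunc M (a + b) (conv f g) * P)`_m = (trunc M a f * trunc M b g * P)`_m}.
Proof.
move=> fa gb m mM; rewrite !coefM; apply: eq_bigr => i _; congr (_ * _).
have iM : (i < M)%N by apply: leq_ltn_trans mM; rewrite -ltnS.
by rewrite coef_poly iM (conv_poly fa gb iM).
Qed.

Let conv_eq a f g : vanishes_below a f -> vanishes_below a g ->
  (forall m : nat, f (a + m%:Z) = g (a + m%:Z)) -> f = g.
Proof.
move=> fa ga fg; apply/funext => n; have [na|an] := ltP n a.
  by rewrite fa ?ga.
have -> : n = a + `|n - a|%N%:Z by lia.
exact: fg.
Qed.

Let convC a b f g :
  vanishes_below a f -> vanishes_below b g -> conv f g = conv g f.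
Proof.
move=> fa gb; apply: (@conv_eq (a + b)).
- exact: conv_below.
- by rewrite addrC; apply: conv_below.
move=> m; rewrite (conv_poly fa gb (leqnn _)) mulrC.
by rewrite -(conv_poly gb fa (leqnn _)) (addrC a).
Qed.

Fact lmulC : commutative lmul.
Proof.
move=> f g; apply: val_inj => /=.
have [a fa] := laurent_bound f; have [b gb] := laurent_bound g.
exact: convC fa gb.
Qed.

Fact lmulA : associative lmul.
Proof.
move=> f g h; apply: val_inj => /=.
have [a fa] := laurent_bound f; have [b gb] := laurent_bound g.
have [c hc] := laurent_bound h.
have fgab := conv_below fa gb; have ghbc := conv_below gb hc.
apply: (@conv_eq (a + b + c)).
- by rewrite -addrA; apply: conv_below.
- exact: conv_below.
move=> m; rewrite -[in LHS](addrA a b c).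
rewrite (conv_poly fa ghbc (leqnn _)) (conv_poly fgab hc (leqnn _)).
rewrite eq_trunc ?inE // mulrC eq_trunc ?inE //.
by rewrite [_ * trunc _ a f]mulrC mulrA.
Qed.

Fact lmul1 : left_id lone lmul.
Proof.
move=> f; apply: val_inj => /=.
have [a fa] := laurent_bound f; have o0 : vanishes_below 0 lone by apply: mono_below.
apply: (@conv_eq a) => //; first by rewrite -[a]add0r; apply: conv_below.
move=> m; rewrite -[a in LHS]add0r conv_nat // big_ord_recl big1 ?addr0.
  by rewrite /= /mono_fun eqxx mul1r subn0.
by move=> i _; rewrite /= mul0r.
Qed.

Lemma lcoefD (f g : laurent) n : lcoef (f + g) n = f n + g n.
Proof. by []. Qed.

Fact lmulDl : left_distributive lmul +%R.
Proof.
move=> f g h; apply: val_inj.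
have [a [fa ga]] := laurent_bound2 f g; have [b hb] := laurent_bound h.
have fga : vanishes_below a (lcoef (f + g)).
  by move=> n na; rewrite lcoefD fa ?ga ?addr0.
have D n : (lmul f h + lmul g h : laurent) n = conv f h n + conv g h n by [].
apply: (@conv_eq (a + b)); first exact: conv_below.
  by move=> n na; rewrite [LHS]D !(conv_below _ hb na) ?addr0.
move=> m; rewrite [RHS]D [LHS](conv_nat _ fga hb) !(conv_nat _ _ hb) //.
by rewrite -big_split /=; apply: eq_bigr => i _; rewrite -mulrDl -lcoefD.
Qed.

Fact lone_neq0 : lone != 0.
Proof.
apply/eqP => /(congr1 (fun f : laurent => f 0)) /=.
by rewrite /mono_fun eqxx => /eqP; rewrite oner_eq0.
Qed.

HB.instance Definition _ := GRing.Zmodule_isComNzRing.Build laurent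
  lmulA lmulC lmul1 lmulDl lone_neq0.

Definition linv (f : laurent) : laurent := xget 0 [set g | g * f = 1].

Definition is_order (f : laurent) (n : int) : Prop :=
  f n != 0 /\ vanishes_below n f.

Lemma is_order_ex (f : laurent) : f != 0 -> exists n, is_order f n.
Proof.
move=> f0; have [a fa] := laurent_bound f.
have exn : exists m : nat, f (a + m%:Z) != 0.
  apply: contrapT => nex; move/eqP: f0; apply; apply: val_inj.
  apply: (@conv_eq a) => // m; apply/eqP/negPn/negP => fm; apply: nex.
  by exists m.
case: (ex_minnP exn) => m fm mmin; exists (a + m%:Z); split => // n nam.
have [na|an] := ltP n a; first exact: fa.
apply/eqP/negPn/negP => fn; have := mmin `|n - a|%N.
have -> : a + `|n - a|%N%:Z = n by lia.
by move=> /(_ fn); lia.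
Qed.

Fact linv0 : linv 0 = 0.
Proof.
rewrite /linv xgetPN // => g /=; rewrite mulr0 => /esym/eqP.
by rewrite oner_eq0.
Qed.

(* Coefficients of the inverse of the power series sum_i F i t^i. *)
Let inv_seq (F : nat -> K) : nat -> seq K :=
  fix rec m := if m isn't m'.+1 then [::] else
    let s := rec m' in
    rcons s ((F 0%N)^-1 * ((m' == 0%N)%:R - \sum_(i < m') s`_i * F (m' - i)%N)).

Let size_inv_seq F m : size (inv_seq F m) = m.
Proof. by elim: m => //= m IH; rewrite size_rcons IH. Qed.

Let inv_coef F m := (inv_seq F m.+1)`_m.

Let inv_seqE F m i : (i < m)%N -> (inv_seq F m)`_i = inv_coef F i.
Proof.
elim: m => // m IH; rewrite ltnS leq_eqVlt => /orP[/eqP-> // | im].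
by rewrite /= nth_rcons size_inv_seq im IH.
Qed.

Let inv_coefP F m : F 0%N != 0 ->
  \sum_(i < m.+1) inv_coef F i * F (m - i)%N = (m == 0%N)%:R.
Proof.
move=> F0; rewrite big_ord_recr /= subnn.
rewrite {2}/inv_coef /= nth_rcons size_inv_seq ltnn eqxx mulrC mulVKf //.
rewrite addrC (eq_bigr (fun i : 'I_m => inv_coef F i * F (m - i)%N)) ?subrK //.
by move=> i _; rewrite inv_seqE.
Qed.

Fact lmulVf (f : laurent) : f != 0 -> linv f * f = 1.
Proof.
move=> /is_order_ex[a [f0 fa]].
have {f0} f0 : f (a + 0%N%:Z) != 0 by rewrite addr0.
pose G (n : int) := if n < - a then 0
                    else inv_coef (fun i => f (a + i%:Z)) (absz (n + a)).
have Ga : vanishes_below (- a) G by move=> n na; rewrite /G na.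
have GP : G \in laurent_pred by apply/laurent_predP; exists (- a).
suff : exists g, g * f = 1 by move=> /(xgetPex 0).
exists (Laurent GP); apply: val_inj; change (conv G f = lone).
apply: (@conv_eq 0); [by rewrite -(addNr a); apply: conv_below|exact: mono_below|].
move=> m; rewrite -(addNr a) conv_nat //= -[RHS]/(mono_fun 1 0 _) addNr add0r.
transitivity ((m == 0%N)%:R : K); last by rewrite /mono_fun; case: m.
rewrite -(@inv_coefP (fun i => f (a + i%:Z)) m f0).
apply: eq_bigr => i _; congr (_ * _); rewrite /G ifF; last by apply/negbTE; lia.
by congr inv_coef; lia.
Qed.

HB.instance Definition _ := GRing.ComNzRing_isField.Build laurent lmulVf linv0.

(* The t-adic valuation; the value 0 at f = 0 is a convention. *)
Definition vL (f : laurent) : int := xget 0 [set n | is_order f n].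

(* K[[t]] and its unit group *)
Definition ints : set laurent := [set f | vanishes_below 0 f].
Definition intunits : set laurent := [set f | is_order f 0].
Definition maxideal : set laurent := [set f | vanishes_below 1 f].

End Laurent.

(* Varieties over k in terms of their K-points, K an algebraic closure of the
   perfect field k.  A reduced k-scheme locally of finite type is determined by
   the set X(K), its k-open subsets and, on each of them, the K-valued functions
   regular over k; its morphisms are the maps on K-points compatible with these.
   A kspace presents such data by a set of points inside an ambient type
   together with partial coordinate systems ("charts"):
   kcoord i p a means that p lies in the domain of the chart i and has the
   coordinate vector a there.  A point may lie in many charts; openness and
   regularity are tested in all of them. *)
Section KVarieties.
Variables (k K : fieldType) (iota : {rmorphism k -> K}).

(* The value at a in K^I of a polynomial over k in the variables I. *)
Definition peval (I : finType) (a : I -> K) (P : mpoly.mpoly #|I| k) : K :=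
  mpoly.mmap iota (fun i => a (enum_val i)) P.

Record kspace := KSpace {
  kpt : Type;
  kcar : set kpt;
  kidx : Type;
  kvars : kidx -> finType;
  kcoord : forall i : kidx, kpt -> (kvars i -> K) -> Prop }.

Arguments kcar : clear implicits.
Arguments kcoord : clear implicits.

Definition kopen (X : kspace) (U : set (kpt X)) : Prop :=
  U `<=` kcar X /\
  forall p i a, U p -> kcoord X i p a ->
    exists Q, peval a Q != 0 /\
      forall p' a', kcar X p' -> kcoord X i p' a' -> peval a' Q != 0 -> U p'.

Definition kregular (X : kspace) (U : set (kpt X)) (f : kpt X -> K) : Prop :=
  forall p i a, U p -> kcoord X i p a ->
    exists P Q, peval a Q != 0 /\
      forall p' a', U p' -> kcoord X i p' a' -> peval a' Q != 0 ->
        f p' = peval a' P / peval a' Q.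

Definition kpreim (X Y : kspace) (f : kpt X -> kpt Y) (V : set (kpt Y)) :
  set (kpt X) := kcar X `&` f @^-1` V.

Definition is_kiso (X Y : kspace) (f : kpt X -> kpt Y) : Prop :=
  [/\ set_bij (kcar X) (kcar Y) f,
      forall V, V `<=` kcar Y -> (kopen V <-> kopen (kpreim f V)) &
      forall V h, kopen V -> (kregular V h <-> kregular (kpreim f V) (h \o f))].

Definition kisomorphic (X Y : kspace) : Prop :=
  exists f : kpt X -> kpt Y, is_kiso f.

Definition affine_space (n : nat) : kspace :=
  @KSpace ('I_n -> K) setT unit (fun=> 'I_n) (fun _ p a => a = p).

(* The disjoint union of copies of Y indexed by the elements of J. *)
Definition kcoprod (T : Type) (J : set T) (Y : kspace) : kspace :=
  @KSpace (T * kpt Y) [set p | J p.1 /\ kcar Y p.2] (T * kidx Y)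
    (fun i => kvars i.2) (fun i p a => p.1 = i.1 /\ kcoord Y i.2 p.2 a).

Definition kcomponent (T : Type) (J : set T) (Y : kspace) (j : T) :
  set (kpt (kcoprod J Y)) := [set p | p.1 = j /\ kcar Y p.2].

End KVarieties.
Arguments kcomponent {K T} J Y j.

Section AffineDeligneLusztig.
Variables (k : finFieldType) (K : fieldType).
Local Notation L := (laurent K).
Local Notation "t^ m" := (mono (1 : K) m) (at level 9, format "t^ m").

Fact frob_laurent (f : L) : (fun n => f n ^+ #|k|) \in @laurent_pred K.
Proof.
have [a fa] := laurent_bound f; apply/laurent_predP; exists a => n na.
by rewrite fa // expr0n -leqn0 leqNgt (introT card_gt0P _) //; exists 0.
Qed.

Definition frob (f : L) : L := Laurent (frob_laurent f).
Local Notation sigma := (map_mx frob).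

Definition mx2 (a b c d : L) : 'M[L]_2 :=
  \matrix_(i, j) if i == 0 then (if j == 0 then a else b)
                 else (if j == 0 then c else d).

Definition gl2 : set 'M[L]_2 := [set g | g \in unitmx].
Definition sl2 : set 'M[L]_2 := [set g | \det g = 1].

Definition torus : set 'M[L]_2 := [set g | gl2 g /\ g 0 1 = 0 /\ g 1 0 = 0].
Definition torus_o : set 'M[L]_2 :=
  [set g | torus g /\ intunits (g 0 0) /\ intunits (g 1 1)].

Definition iwahori : set 'M[L]_2 :=
  [set g | [/\ intunits (g 0 0), ints (g 0 1), maxideal (g 1 0)
             & intunits (g 1 1)]].

Definition lcoset (x : 'M[L]_2) (A : set 'M[L]_2) : set 'M[L]_2 :=
  [set x *m a | a in A].

Definition b1 : 'M[L]_2 := mx2 0 1 (t^ 1) 0.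

(* N_{SL_2}(T^{SL_2})(L), as the normalizer of T^{SL_2}(L) in SL_2(L): L is
   infinite, hence T^{SL_2}(L) is dense in T^{SL_2}. *)
Definition sl2_normT : set 'M[L]_2 :=
  [set n | sl2 n /\
     [set n *m x *m invmx n | x in torus `&` sl2] = torus `&` sl2].

Definition Wclass (n : 'M[L]_2) : set 'M[L]_2 := lcoset n (torus_o `&` sl2).

Definition Wa : set (set 'M[L]_2) := [set Wclass n | n in sl2_normT].

Definition wlength (w : set 'M[L]_2) : nat :=
  xget 0%N [set l | exists s : int,
    (w = Wclass (mx2 (t^ (- s)) 0 0 (t^ s)) /\ l = absz (2 * s)%R) \/
    (w = Wclass (mx2 0 (t^ (- s)) (- t^ s) 0) /\ l = absz (2 * s - 1)%R)].

(* The element (w, v) of the extended affine Weyl group N_{GL_2}(T)(L)/T(o):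
   the class of w b_1^v. *)
Definition Wtilde (w : set 'M[L]_2) (v : int) : set 'M[L]_2 :=
  [set n *m (b1 ^ v) *m x | n in w & x in torus_o].

Definition double_coset (w : set 'M[L]_2) : set 'M[L]_2 :=
  [set y | exists i n j, [/\ iwahori i, w n, iwahori j & y = i *m n *m j]].

Definition ADL_GL (w : set 'M[L]_2) (b : 'M[L]_2) : set (set 'M[L]_2) :=
  [set c | exists x, [/\ gl2 x, c = lcoset x iwahori &
     double_coset (Wtilde w (vL (\det b))) (invmx x *m b *m sigma x)]].

Definition ADL_SL (w : set 'M[L]_2) (b : 'M[L]_2) : set (set 'M[L]_2) :=
  [set c | exists x, [/\ sl2 x, c = lcoset x (iwahori `&` sl2) &
     double_coset (Wtilde w (vL (\det b))) (invmx x *m b *m sigma x)]].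

Definition Jgroup (b : 'M[L]_2) : set 'M[L]_2 :=
  [set g | gl2 g /\ invmx g *m b *m sigma g = b].
Definition Hgroup (b : 'M[L]_2) : set 'M[L]_2 :=
  [set g | Jgroup b g /\ vL (\det g) = 0].
Definition JmodH (b : 'M[L]_2) : set (set 'M[L]_2) :=
  [set lcoset g (Hgroup b) | g in Jgroup b].

(* The affine flag manifold, as chains of lattices.  The base chain
   o e_1 + p e_2 < o e_1 + o e_2 has stabilizer I, and the coset xI (or
   xI^{SL_2}) corresponds to its image under x. *)
Definition base0 : set 'cV[L]_2 := [set u | ints (u 0 0) /\ maxideal (u 1 0)].
Definition base1 : set 'cV[L]_2 := [set u | ints (u 0 0) /\ ints (u 1 0)].

Definition lat (B : set 'cV[L]_2) (c : set 'M[L]_2) : set 'cV[L]_2 :=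
  [set x *m u | x in c & u in B].

(* The N-th closed piece of the Ind-scheme: chains between t^N o^2 and
   t^-N o^2. *)
Definition bounded_chain (N : nat) (c : set 'M[L]_2) : Prop :=
  (forall u, base1 u -> lat base0 c (t^ (N%:Z) *: u)) /\
  (forall u, lat base1 c u -> base1 (t^ (N%:Z) *: u)).

(* Index set of the basis t^m e_i, -N <= m < N, of t^-N o^2 / t^N o^2;
   m is the second component minus N. *)
Definition bidx (N : nat) : finType := ('I_2 * 'I_(N + N))%type.

Definition bvec (N : nat) (j : bidx N) (c : K) : 'cV[L]_2 :=
  mono c ((j.2 : nat)%:Z - N%:Z) *: delta_mx j.1 0.

(* The standard affine charts of the Grassmannian of t^-N o^2 / t^N o^2:
   M lies in the chart of S iff M is a complement of the span of the basis
   vectors in S; its coordinates a give the projection onto this span along M,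
   e_j = sum_(s in S) a_(j,s) e_s modulo M. *)
Definition gr_coord (N : nat) (S : {set bidx N}) (M : set 'cV[L]_2)
    (a : bidx N -> bidx N -> K) : Prop :=
  [/\ forall j, M (bvec j 1 - \sum_(s in S) bvec s (a j s)),
      forall c : bidx N -> K, M (\sum_(s in S) bvec s (c s)) ->
        forall s, s \in S -> c s = 0 &
      forall j s, s \notin S -> a j s = 0].

Definition flag_chart : Type := {N : nat & ({set bidx N} * {set bidx N})%type}.

(* The reduced subspace of the affine flag manifold with point set Z.  Each
   bounded piece has its structure from a product of two Grassmannians; as the
   charts of all the pieces are used, openness and regularity on Z are those of
   the direct limit. *)
Definition flag_space (Z : set (set 'M[L]_2)) : kspace K :=
  @KSpace K (set 'M[L]_2) Z flag_chart
    (fun i => (bool * bidx (projT1 i) * bidx (projT1 i))%type)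
    (fun i c a =>
      [/\ bounded_chain (projT1 i) c,
          gr_coord (projT2 i).1 (lat base0 c) (fun j s => a (false, j, s)) &
          gr_coord (projT2 i).2 (lat base1 c) (fun j s => a (true, j, s))]).

End AffineDeligneLusztig.
Arguments Wa : clear implicits.

(* Main.v *)
(* Conjugation by b1 preserves the Iwahori group I and exchanges the two affine
   simple reflections, so X_w(b1) consists of the chambers x I whose position
   relative to tau (x I) is w, where tau = b1 sigma(.) b1^-1.  In the tree of SL_2
   the map tau flips the base edge, hence a chamber at distance d from the base
   chamber has distance 2 d from its image, and the relative position determines
   d and the side on which the chamber lies.  Thus X_w^{SL_2}(b1) is a single
   Schubert cell I v I / I of dimension d = l(w) / 2.  It consists of the chains
   of lattices o t^m (e_l + b e_u) + o t^n e_u with b a polynomial in t with d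
   coefficients.  These coefficients occur linearly in the equations of the
   lattice in any chart of the Grassmannian, so that they are recovered by
   Cramer's rule; the number of equations of the lattice determines v(det x),
   which separates the components for GL_2. *)
From HB Require Import structures.
Require Import Defs.
From mathcomp Require Import all_boot all_order all_algebra.
From mathcomp Require Import pgroup abelian finfield.
From mathcomp Require Import boolp classical_sets functions.
From mathcomp Require Import -(notations) mpoly.
From mathcomp Require Import zify ring.
Set Implicit Arguments. Unset Strict Implicit. Unset Printing Implicit Defensive.
Import Order.TTheory GRing.Theory Num.Theory.
Local Open Scope classical_set_scope.
Local Open Scope ring_scope.

Local Notation "t^ m" := (mono 1 m) (at level 9, format "t^ m").

(** * Valuations and Frobenius on Laurent series *)

Section LaurentValuation.
Variable K : fieldType.
Implicit Types f g : laurent K.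

(** No equation involving the Frobenius ever has to be solved. On a cell u(b) v I the product x^-1
    tau(x) contains b only through a factor of Gauss type whose pivot is a unit for every admissible
    b, so the relative position is constant on the cell. The cells exhaust the determinants of order
    0, and the positions attached to different cells are pairwise different and always diagonal;
    this gives equality with one cell and also shows that an antidiagonal w has empty X_w.

    The geometric half is asymmetric. The map out of affine space may choose its chart, and in the
    standard charts it is polynomial. Its inverse must be rational in every chart of every bounded
    piece, including charts unrelated to the cell. Moreover, the two lattices of a chain differ by
    one dimension, and a single one of them need not see all the coefficients of b; which one does
    depends on the cell. Both SL_2 and GL_2 are therefore treated by one statement about families of
    cells, with a one-element index set for SL_2. *)

Definition val_ge (m : int) f : Prop := vanishes_below m f.

Lemma val_geW m n f : m <= n -> val_ge n f -> val_ge m f.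
Proof. exact: vanishes_below_le. Qed.

Lemma val_ge0 m : val_ge m (0 : laurent K).
Proof. by []. Qed.

Lemma val_geD m f g : val_ge m f -> val_ge m g -> val_ge m (f + g).
Proof. by move=> fm gm n nm; rewrite lcoefD fm ?gm ?addr0. Qed.

Lemma lcoefN f n : lcoef (- f) n = - f n.
Proof. by []. Qed.

Lemma val_geN m f : val_ge m f -> val_ge m (- f).
Proof. by move=> fm n nm; rewrite lcoefN fm ?oppr0. Qed.

Lemma val_geB m f g : val_ge m f -> val_ge m g -> val_ge m (f - g).
Proof. by move=> fm /val_geN; apply: val_geD. Qed.

Lemma val_geM m n f g : val_ge m f -> val_ge n g -> val_ge (m + n) (f * g).
Proof. exact: conv_below. Qed.

Lemma val_ge_sum (I : Type) (r : seq I) (P : pred I) m (F : I -> laurent K) :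
  (forall i, P i -> val_ge m (F i)) -> val_ge m (\sum_(i <- r | P i) F i).
Proof. by move=> h; elim/big_ind: _ => //; exact: val_geD. Qed.

Lemma val_ge_mono c m : val_ge m (mono (c : K) m).
Proof. exact: mono_below. Qed.

Lemma lcoefM_lead m n f g :
  val_ge m f -> val_ge n g -> lcoef (f * g) (m + n) = f m * g n.
Proof.
move=> fm gn; rewrite -[m + n]addr0.
by rewrite [LHS](@conv_nat _ m n f g 0) // big_ord1 /= subnn !addr0.
Qed.

Lemma is_order_ge m f : is_order f m -> val_ge m f.
Proof. by case. Qed.

Lemma is_order_neq0 m f : is_order f m -> f != 0.
Proof. by case=> fm _; apply: contra_neq fm => ->. Qed.

Lemma is_order_le m n f : is_order f m -> val_ge n f -> n <= m.
Proof. by case=> fm _ fn; rewrite leNgt; apply: contra_neqN fm => /fn. Qed.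

Lemma is_order_inj m n f : is_order f m -> is_order f n -> m = n.
Proof.
by move=> fm fn; apply/le_anti; rewrite (is_order_le fm fn.2) (is_order_le fn fm.2).
Qed.

Lemma is_orderM m n f g :
  is_order f m -> is_order g n -> is_order (f * g) (m + n).
Proof.
move=> [fm fm'] [gn gn']; split; last exact: val_geM.
by rewrite lcoefM_lead // mulf_neq0.
Qed.

Lemma is_orderM_eq m n p f g :
  is_order f m -> is_order g n -> m + n = p -> is_order (f * g) p.
Proof. by move=> fm gn <-; exact: is_orderM. Qed.

Lemma val_geM_le m n p f g :
  val_ge m f -> val_ge n g -> p <= m + n -> val_ge p (f * g).
Proof. by move=> fm gn /val_geW; apply; exact: val_geM. Qed.

Lemma is_orderDl m f g : is_order f m -> val_ge (m + 1) g -> is_order (f + g) m.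
Proof.
move=> [fm fm'] gm; split; first by rewrite lcoefD gm ?addr0 //; lia.
by apply: val_geD => //; apply: val_geW gm; lia.
Qed.

Lemma is_orderN m f : is_order f m -> is_order (- f) m.
Proof. by case=> fm fm'; split; [rewrite lcoefN oppr_eq0 | apply: val_geN]. Qed.

Lemma is_order_mono m : is_order (t^m : laurent K) m.
Proof. by split; [rewrite /= /mono_fun eqxx oner_eq0 | apply: mono_below]. Qed.

Lemma is_order1 : is_order (1 : laurent K) 0.
Proof. exact: is_order_mono. Qed.

Lemma is_orderV m f : is_order f m -> is_order f^-1 (- m).
Proof.
move=> fm; have f0 := is_order_neq0 fm.
have [n fn] : exists n, is_order f^-1 n by apply: is_order_ex; rewrite invr_eq0.
have := is_orderM fm fn; rewrite mulfV // => /is_order_inj/(_ is_order1) mn0.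
by have -> : - m = n by lia.
Qed.

Lemma vL_order m f : is_order f m -> vL f = m.
Proof. by move=> fm; apply: xget_unique => // n /is_order_inj; exact. Qed.

Lemma is_order_vL f : f != 0 -> is_order f (vL f).
Proof. by move=> /is_order_ex[n fn]; rewrite (vL_order fn). Qed.

Lemma vLM f g : f != 0 -> g != 0 -> vL (f * g) = vL f + vL g.
Proof. by move=> f0 g0; apply/vL_order/is_orderM; apply: is_order_vL. Qed.

Lemma lcoef_monoM c m f n : lcoef (mono (c : K) m * f) n = c * f (n - m).
Proof.
have [a fa] := laurent_bound f.
have [na|an] := ltP n (m + a).
  rewrite (val_geM (@val_ge_mono c m) fa) // fa ?mulr0 //; lia.
have -> : n = m + a + (absz (n - m - a)%R)%:Z by lia.
rewrite [LHS](conv_nat _ (@mono_below _ c m) fa) big_ord_recl big1 => [|i _].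
  rewrite addr0 /= /mono_fun addr0 eqxx subn0; congr (_ * f _); lia.
by rewrite /= /mono_fun ifF ?mul0r //; apply/negbTE; rewrite /bump; lia.
Qed.

Lemma monoD m n : t^(m + n) = t^m * t^n :> laurent K.
Proof.
apply: laurent_eqP => i; rewrite lcoef_monoM mul1r /= /mono_fun.
by congr (if _ then _ else _); apply/eqP/eqP; lia.
Qed.

Lemma mono0 : t^0 = 1 :> laurent K.
Proof. by []. Qed.

Lemma mono_neq0 m : t^m != 0 :> laurent K.
Proof. exact: is_order_neq0 (is_order_mono m). Qed.

Lemma monoN m : t^(- m) = (t^m)^-1 :> laurent K.
Proof.
by apply: (mulfI (mono_neq0 m)); rewrite mulfV ?mono_neq0 // -monoD subrr.
Qed.

Lemma val_geMl m n f g : is_order f m -> val_ge (m + n) (f * g) <-> val_ge n g.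
Proof.
move=> fm; split=> h; last by apply: val_geM => //; case: fm.
rewrite -[g](mulKf (is_order_neq0 fm)).
by rewrite -[n](addKr m); apply: val_geM h; case: (is_orderV fm).
Qed.

Lemma monocE c d m : mono (c * d : K) m = mono c 0 * mono d m.
Proof.
apply: laurent_eqP => n; rewrite lcoef_monoM /= /mono_fun subr0.
by case: ifP => _; rewrite ?mulr0.
Qed.

Lemma mono_add (c d : K) m : mono (c + d) m = mono c m + mono d m.
Proof.
apply: laurent_eqP => n; rewrite lcoefD /= /mono_fun.
by case: ifP => _; rewrite ?addr0.
Qed.

Lemma mono_zero m : mono (0 : K) m = 0.
Proof. by apply: laurent_eqP => n; rewrite /= /mono_fun if_same. Qed.

Lemma lcoef_sum (I : Type) (r : seq I) (P : pred I) (F : I -> laurent K) n :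
  lcoef (\sum_(i <- r | P i) F i) n = \sum_(i <- r | P i) lcoef (F i) n.
Proof.
by elim/big_rec2: _ => // i x f _ <-; rewrite lcoefD.
Qed.

Definition lpoly (e : int) d (p : 'I_d -> K) : laurent K :=
  \sum_(j < d) mono (p j) (e + j%:Z).

Lemma lpoly_coef e d (p : 'I_d -> K) (j : 'I_d) : lpoly e p (e + j%:Z) = p j.
Proof.
rewrite lcoef_sum (bigD1 j) //= /mono_fun eqxx big1 ?addr0 // => i ij.
by rewrite ifF //; apply/negP => /eqP; move/eqP: ij => + ji; apply; apply: val_inj => /=; lia.
Qed.

Lemma val_ge_lpoly e d (p : 'I_d -> K) : val_ge e (lpoly e p).
Proof.
by apply: val_ge_sum => j _; apply: val_geW (@val_ge_mono _ _); lia.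
Qed.

Lemma lpoly_approx e d f : val_ge e f ->
  exists p : 'I_d -> K, val_ge (e + d%:Z) (f - lpoly e p).
Proof.
move=> fe; exists (fun j => f (e + j%:Z)) => n nd.
rewrite lcoefD lcoefN; have [ne|en] := ltP n e.
  by rewrite fe // val_ge_lpoly // subr0.
have ned : (absz (n - e)%R < d)%N by lia.
have -> : n = e + (Ordinal ned)%:Z by rewrite /=; lia.
by rewrite lpoly_coef subrr.
Qed.

Lemma lpoly_inj e d (p q : 'I_d -> K) :
  val_ge (e + d%:Z) (lpoly e p - lpoly e q) -> p = q.
Proof.
move=> h; apply/funext => j; rewrite -(lpoly_coef e p) -(lpoly_coef e q).
apply/eqP; rewrite -subr_eq0 -lcoefN -lcoefD; apply/eqP/h.
by have := ltn_ord j; lia.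
Qed.

End LaurentValuation.

Section Frobenius.
Variables (k : finFieldType) (K : fieldType) (iota : {rmorphism k -> K}).
Implicit Types f g : laurent K.

(** [iota] forces K to have the characteristic p of k, and the cardinal of k is a power of p.
    Raising to this power is therefore additive on K, which makes [frob] a ring endomorphism. *)
Lemma pchar_nat_card : [pchar K].-nat #|k|.
Proof.
have [p p_pr kp] := finPcharP k.
have := abelem_pgroup (fin_ring_pchar_abelem kp); rewrite /pgroup cardsT.
apply: sub_in_pnat => r _ /eqP->; by rewrite (fmorph_pchar iota).
Qed.

Lemma frobD f g : frob k (f + g) = frob k f + frob k g.
Proof. by apply: laurent_eqP => n /=; rewrite exprDn_pchar // pchar_nat_card. Qed.

Lemma card_field_gt0 : (0 < #|k|)%N.
Proof. by rewrite (introT card_gt0P _) //; exists 0. Qed.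

Lemma val_ge_frob m f : val_ge m f -> val_ge m (frob k f).
Proof. by move=> fm n nm /=; rewrite fm // expr0n -leqn0 leqNgt card_field_gt0. Qed.

Lemma frobM f g : frob k (f * g) = frob k f * frob k g.
Proof.
have [a fa] := laurent_bound f; have [b gb] := laurent_bound g.
apply: laurent_eqP => n; have [nab|nab] := ltP n (a + b).
  by rewrite (val_geM (val_ge_frob fa) (val_ge_frob gb)) // (val_ge_frob (val_geM fa gb)).
have -> : n = a + b + (absz (n - a - b)%R)%:Z by lia.
rewrite [RHS](conv_nat _ (val_ge_frob fa) (val_ge_frob gb)).
rewrite [LHS]/= (conv_nat _ fa gb).
rewrite (big_morph (fun x : K => x ^+ #|k|) (id1 := 0) (op1 := +%R)).
- by apply: eq_bigr => i _; rewrite exprMn.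
- by move=> x y; rewrite exprDn_pchar // pchar_nat_card.
- by rewrite expr0n -leqn0 leqNgt card_field_gt0.
Qed.

Lemma frob_mono m : frob k (t^m) = t^m :> laurent K.
Proof.
apply: laurent_eqP => n /=; rewrite /mono_fun; case: ifP; rewrite ?expr1n //.
by rewrite expr0n -leqn0 leqNgt card_field_gt0.
Qed.

Lemma frob0 : frob k (0 : laurent K) = 0.
Proof. by apply: laurent_eqP => n /=; rewrite expr0n -leqn0 leqNgt card_field_gt0. Qed.

Lemma frob1 : frob k (1 : laurent K) = 1.
Proof. exact: frob_mono. Qed.

Lemma frobN f : frob k (- f) = - frob k f.
Proof. by apply/eqP; rewrite -addr_eq0 -frobD addNr frob0. Qed.

Lemma is_order_frob m f : is_order f m -> is_order (frob k f) m.
Proof. by case=> f0 fm; split; [rewrite /= expf_neq0 | apply: val_ge_frob]. Qed.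

End Frobenius.

(** * Double cosets of the Iwahori group *)

Section Matrices2.
Variable K : fieldType.
Local Notation L := (laurent K).
Implicit Types (a b c d : L) (M g i j x y z n : 'M[L]_2).

Lemma mx2E M : M = mx2 (M 0 0) (M 0 1) (M 1 0) (M 1 1).
Proof.
by apply/matrixP=> -[[|[|//]] r] [[|[|//]] s]; rewrite !mxE /=; congr (M _ _); apply: val_inj.
Qed.

Lemma mx2_entries a b c d :
  [/\ mx2 a b c d 0 0 = a, mx2 a b c d 0 1 = b,
      mx2 a b c d 1 0 = c & mx2 a b c d 1 1 = d].
Proof. by rewrite !mxE. Qed.

Lemma mx2_inj a b c d a' b' c' d' :
  mx2 a b c d = mx2 a' b' c' d' -> [/\ a = a', b = b', c = c' & d = d'].
Proof.
move=> /matrixP e.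
by split; [move: (e 0 0)|move: (e 0 1)|move: (e 1 0)|move: (e 1 1)]; rewrite !mxE.
Qed.

Lemma mx2M a b c d a' b' c' d' :
  mx2 a b c d *m mx2 a' b' c' d' =
  mx2 (a * a' + b * c') (a * b' + b * d') (c * a' + d * c') (c * b' + d * d').
Proof.
by apply/matrixP=> -[[|[|//]] r] [[|[|//]] s]; rewrite !mxE !big_ord_recl big_ord0 !mxE addr0.
Qed.

Lemma mx2_1 : mx2 1 0 0 1 = 1%:M :> 'M[L]_2.
Proof. by rewrite [RHS]mx2E !mxE. Qed.

Lemma det_mx2 a b c d : \det (mx2 a b c d) = a * d - b * c.
Proof.
by rewrite (expand_det_row _ 0) !big_ord_recl big_ord0 /cofactor !det_mx11 !mxE /=; ring.
Qed.

Lemma gl2E M : gl2 M <-> \det M != 0.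
Proof. by rewrite /gl2 /= unitmxE unitfE. Qed.

Lemma invmx_mx2 a b c d : a * d - b * c != 0 ->
  let D := (a * d - b * c)^-1 in
  invmx (mx2 a b c d) = mx2 (d * D) (- b * D) (- c * D) (a * D).
Proof.
move=> D0 D; have E : mx2 (d * D) (- b * D) (- c * D) (a * D) *m mx2 a b c d = 1%:M.
  have Dv : (a * d - b * c) * D = 1 by rewrite mulfV.
  by rewrite mx2M -mx2_1; congr mx2; rewrite -?Dv; ring.
have u : mx2 a b c d \in unitmx by rewrite unitmxE unitfE det_mx2.
by rewrite -[LHS]mul1mx -E -mulmxA mulmxV // mulmx1.
Qed.

Lemma map_mx2 (f : L -> L) a b c d :
  map_mx f (mx2 a b c d) = mx2 (f a) (f b) (f c) (f d).
Proof. by rewrite [LHS]mx2E !mxE. Qed.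

Lemma iwahori_mx2 a b c d :
  iwahori (mx2 a b c d) <->
  [/\ is_order a 0, val_ge 0 b, val_ge 1 c & is_order d 0].
Proof. by rewrite /iwahori /=; have [-> -> -> ->] := mx2_entries a b c d. Qed.

Lemma is_order_iwahori_det a b c d :
  iwahori (mx2 a b c d) -> is_order (a * d - b * c) 0.
Proof.
move=> /iwahori_mx2[a0 b0 c0 d0]; apply: (is_orderDl (m := 0)); first exact: is_orderM a0 d0.
by apply/val_geN/(val_geM b0 c0).
Qed.

Lemma det_iwahori g : iwahori g -> is_order (\det g) 0.
Proof. by rewrite [g]mx2E det_mx2; exact: is_order_iwahori_det. Qed.

Lemma iwahori_gl2 g : iwahori g -> gl2 g.
Proof. by move=> /det_iwahori/is_order_neq0 ?; apply/gl2E. Qed.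

Lemma iwahori1 : iwahori (1%:M : 'M[L]_2).
Proof. by rewrite -mx2_1; apply/iwahori_mx2; split=> //; exact: is_order1. Qed.

Lemma iwahoriM g h : iwahori g -> iwahori h -> iwahori (g *m h : 'M[L]_2).
Proof.
rewrite [g]mx2E [h]mx2E mx2M => /iwahori_mx2[a b c d] /iwahori_mx2[a' b' c' d'].
apply/iwahori_mx2; split.
- by apply: (is_orderDl (m := 0)); [exact: is_orderM a a' | exact: val_geM b c'].
- apply: val_geD; first exact: val_geM (is_order_ge a) b'.
  exact: val_geM b (is_order_ge d').
- apply: val_geD; first exact: val_geM c (is_order_ge a').
  exact: val_geM (is_order_ge d) c'.
- rewrite addrC; apply: (is_orderDl (m := 0)); first exact: is_orderM d d'.
  exact: val_geM c b'.
Qed.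

Lemma iwahoriV g : iwahori g -> iwahori (invmx g).
Proof.
rewrite [g]mx2E => Ig; have D := is_order_iwahori_det Ig.
rewrite invmx_mx2 ?(is_order_neq0 D) //; case/iwahori_mx2: Ig => a b c d.
have := is_orderV D; rewrite oppr0 => V; apply/iwahori_mx2; split.
- exact: is_orderM d V.
- exact: val_geM (val_geN b) (is_order_ge V).
- exact: val_geM (val_geN c) (is_order_ge V).
- exact: is_orderM a V.
Qed.

Lemma iwahori_lower c : val_ge 1 c -> iwahori (mx2 1 0 c 1).
Proof. by move=> c1; apply/iwahori_mx2; split=> //; exact: is_order1. Qed.

Lemma iwahori_upper b : val_ge 0 b -> iwahori (mx2 1 b 0 1).
Proof. by move=> b0; apply/iwahori_mx2; split=> //; exact: is_order1. Qed.

Lemma iwahori_diag a d : is_order a 0 -> is_order d 0 -> iwahori (mx2 a 0 0 d).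
Proof. by move=> a0 d0; apply/iwahori_mx2. Qed.

Lemma det_b1 : \det (b1 K) = - t^1.
Proof. by rewrite det_mx2 mul0r mul1r sub0r. Qed.

Lemma vL_det_b1 : vL (\det (b1 K)) = 1.
Proof. by rewrite det_b1; apply/vL_order/is_orderN/is_order_mono. Qed.

Lemma b1_gl2 : b1 K \in unitmx.
Proof. by apply/gl2E; rewrite det_b1 oppr_eq0 mono_neq0. Qed.

Lemma invmx_b1 : invmx (b1 K) = mx2 0 (t^(-1)) 1 0.
Proof.
have E : mx2 0 (t^(-1)) 1 0 *m b1 K = 1%:M.
  rewrite mx2M -mx2_1 !(mul0r, mulr0, mul1r, mulr1, add0r, addr0).
  by rewrite monoN mulVf ?mono_neq0.
by rewrite -[LHS]mul1mx -E -mulmxA mulmxV ?b1_gl2 // mulmx1.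
Qed.

Lemma conj_b1 a b c d :
  b1 K *m mx2 a b c d *m invmx (b1 K) = mx2 d (c * t^(-1)) (t^1 * b) a.
Proof.
rewrite invmx_b1 !mx2M !(mul0r, mulr0, mul1r, mulr1, add0r, addr0).
by rewrite monoN mulrAC mulfV ?mono_neq0 // mul1r.
Qed.

Lemma conjV_b1 a b c d :
  invmx (b1 K) *m mx2 a b c d *m b1 K = mx2 d (t^(-1) * c) (b * t^1) a.
Proof.
rewrite invmx_b1 !mx2M !(mul0r, mulr0, mul1r, mulr1, add0r, addr0).
by rewrite monoN mulrAC mulVf ?mono_neq0 // mul1r.
Qed.

Lemma iwahori_conj_b1 g : iwahori g -> iwahori (b1 K *m g *m invmx (b1 K)).
Proof.
rewrite [g]mx2E conj_b1 => /iwahori_mx2[a b c d]; apply/iwahori_mx2; split=> //.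
  exact: (val_geM c (is_order_ge (is_order_mono _ (-1)))).
exact: (val_geM (is_order_ge (is_order_mono _ 1)) b).
Qed.

Lemma iwahori_conjV_b1 g : iwahori g -> iwahori (invmx (b1 K) *m g *m b1 K).
Proof.
rewrite [g]mx2E conjV_b1 => /iwahori_mx2[a b c d]; apply/iwahori_mx2; split=> //.
  exact: (val_geM (is_order_ge (is_order_mono _ (-1))) c).
exact: (val_geM b (is_order_ge (is_order_mono _ 1))).
Qed.

Lemma torus_o_iwahori g : torus_o g -> iwahori g.
Proof.
rewrite [g]mx2E => -[[_ ]]; have [-> -> -> ->] := mx2_entries (g 0 0) (g 0 1) (g 1 0) (g 1 1).
by move=> [-> ->] [? ?]; apply: iwahori_diag.
Qed.

Lemma torus_o1 : torus_o (1%:M : 'M[L]_2).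
Proof.
by split; [split; [exact: unitmx1|rewrite !mxE]|rewrite !mxE; split; exact: is_order1].
Qed.

Definition iwahori_double n : set 'M[L]_2 :=
  [set z | exists i j, [/\ iwahori i, iwahori j & z = i *m n *m j]].

(* Moving b1, which normalizes I, to the right. *)
Lemma double_coset_Wtilde n y :
  double_coset (Wtilde (Wclass n) 1) y <-> iwahori_double n (y *m invmx (b1 K)).
Proof.
split.
  move=> [i [_ [j [Ii [_ [h [hT _] <-] [x xT <-]] Ij ->]]]].
  exists i, (h *m (b1 K *m (x *m j) *m invmx (b1 K))); split=> //.
    apply: iwahoriM; first exact: torus_o_iwahori.
    by apply/iwahori_conj_b1/iwahoriM => //; apply: torus_o_iwahori.
  by rewrite expr1z !mulmxA.
move=> [i [j [Ii Ij E]]]; exists i, (n *m b1 K), (invmx (b1 K) *m j *m b1 K).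
split=> //; last first.
- by rewrite -[y](mulmxKV b1_gl2) E !mulmxA mulmxK // b1_gl2.
- exact: iwahori_conjV_b1.
exists n; last by exists 1%:M; rewrite ?mulmx1 ?expr1z //; exact: torus_o1.
exists 1%:M; rewrite ?mulmx1 //; split; first exact: torus_o1.
by rewrite /sl2 /= det1.
Qed.

Definition wdiag (s : int) : 'M[L]_2 := mx2 (t^(- s)) 0 0 (t^s).
Definition wanti (s : int) : 'M[L]_2 := mx2 0 (t^(- s)) (- t^s) 0.

Lemma val_geM3 (f g h : L) (m n p q : int) :
    val_ge m f -> val_ge n g -> val_ge p h -> q <= m + n + p ->
  val_ge q (f * g * h : L).
Proof. by move=> fm gn hp le_q; apply: val_geW le_q _; exact: val_geM (val_geM fm gn) hp. Qed.

Lemma is_orderM3 (f g h : L) (m n p : int) :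
    is_order f m -> is_order g n -> is_order h p ->
  is_order (f * g * h : L) (m + n + p).
Proof. by move=> fm gn hp; exact: is_orderM (is_orderM fm gn) hp. Qed.

(** The entry of known order is the one where the lower power of t meets diagonal units of both
    Iwahori factors. The bounds [1 - s] and [1 + s] gain their 1 from a factor in the maximal ideal;
    this gain separates the double cosets. *)
Lemma iwahori_double_diag s z : iwahori_double (wdiag s) z ->
  (0 <= s -> [/\ is_order (z 0 0) (- s), val_ge (- s) (z 0 1),
                 val_ge (1 - s) (z 1 0) & val_ge (- s) (z 1 1)]) /\
  (s < 0 -> [/\ is_order (z 1 1) s, val_ge (1 + s) (z 0 0),
                 val_ge (1 + s) (z 1 0) & val_ge s (z 0 1)]).
Proof.
move=> [i [j [+ + ->]]]; rewrite [i]mx2E [j]mx2E.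
move: (i 0 0) (i 0 1) (i 1 0) (i 1 1) => a b c d.
move: (j 0 0) (j 0 1) (j 1 0) (j 1 1) => a' b' c' d'.
move=> /iwahori_mx2[ha hb hc hd] /iwahori_mx2[ha' hb' hc' hd'].
rewrite !mx2M !(mulr0, add0r, addr0).
case: (mx2_entries (a * t^(- s) * a' + b * t^s * c') (a * t^(- s) * b' + b * t^s * d')
   (c * t^(- s) * a' + d * t^s * c') (c * t^(- s) * b' + d * t^s * d')) => -> -> -> ->.
have [[_ va] [_ vd] [_ va'] [_ vd']] := And4 ha hd ha' hd'.
have hs := is_order_mono K s; have hsN := is_order_mono K (- s).
have [[_ vs] [_ vsN]] := conj hs hsN.
split=> s0; split;
 try (apply: val_geD; (apply: val_geM3; [eassumption|eassumption|eassumption|lia])).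
- move: (is_orderM3 ha hsN ha'); rewrite add0r addr0.
  move/is_orderDl; apply.
  by apply: val_geM3; [eassumption|eassumption|eassumption|lia].
- rewrite addrC; move: (is_orderM3 hd hs hd'); rewrite add0r addr0.
  move/is_orderDl; apply.
  by apply: val_geM3; [eassumption|eassumption|eassumption|lia].
Qed.

Lemma iwahori_double_anti s z : iwahori_double (wanti s) z ->
  (0 < s -> [/\ is_order (z 0 1) (- s), val_ge (1 - s) (z 0 0),
                 val_ge (1 - s) (z 1 0) & val_ge (1 - s) (z 1 1)]) /\
  (s <= 0 -> [/\ is_order (z 1 0) s, val_ge s (z 0 0),
                 val_ge s (z 0 1) & val_ge s (z 1 1)]).
Proof.
move=> [i [j [+ + ->]]]; rewrite [i]mx2E [j]mx2E.
move: (i 0 0) (i 0 1) (i 1 0) (i 1 1) => a b c d.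
move: (j 0 0) (j 0 1) (j 1 0) (j 1 1) => a' b' c' d'.
move=> /iwahori_mx2[ha hb hc hd] /iwahori_mx2[ha' hb' hc' hd'].
rewrite !mx2M !(mulr0, add0r, addr0).
case: (mx2_entries (b * - t^s * a' + a * t^(- s) * c') (b * - t^s * b' + a * t^(- s) * d')
   (d * - t^s * a' + c * t^(- s) * c') (d * - t^s * b' + c * t^(- s) * d')) => -> -> -> ->.
have [[_ va] [_ vd] [_ va'] [_ vd']] := And4 ha hd ha' hd'.
have hs := is_orderN (is_order_mono K s); have hsN := is_order_mono K (- s).
have [[_ vs] [_ vsN]] := conj hs hsN.
split=> s0; split;
 try (apply: val_geD; (apply: val_geM3; [eassumption|eassumption|eassumption|lia])).
- rewrite addrC; move: (is_orderM3 ha hsN hd'); rewrite add0r addr0.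
  move/is_orderDl; apply.
  by apply: val_geM3; [eassumption|eassumption|eassumption|lia].
- move: (is_orderM3 hd hs ha'); rewrite add0r addr0.
  move/is_orderDl; apply.
  by apply: val_geM3; [eassumption|eassumption|eassumption|lia].
Qed.

Lemma iwahori_double_diag_inj s s' z :
  iwahori_double (wdiag s) z -> iwahori_double (wdiag s') z -> s = s'.
Proof.
move=> /iwahori_double_diag[P N] /iwahori_double_diag[P' N'].
have [s0|s0] := leP 0 s; have [s0'|s0'] := leP 0 s'.
- have [z0 _ _ _] := P s0; have [z0' _ _ _] := P' s0'.
  by have := is_order_inj z0 z0'; lia.
- have [z0 _ _ z1] := P s0; have [z0' z1' _ _] := N' s0'.
  by have := is_order_le z0 z1'; have := is_order_le z0' z1; lia.
- have [z0 _ _ z1] := P' s0'; have [z0' z1' _ _] := N s0.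
  by have := is_order_le z0 z1'; have := is_order_le z0' z1; lia.
- have [z0 _ _ _] := N s0; have [z0' _ _ _] := N' s0'.
  exact: is_order_inj z0 z0'.
Qed.

(** Each description knows the exact order of one entry and bounds the entry singled out by the
    other. The two resulting inequalities go in opposite directions, and one of them is strict. *)
Lemma iwahori_double_diag_anti s s' z :
  iwahori_double (wdiag s) z -> ~ iwahori_double (wanti s') z.
Proof.
move=> /iwahori_double_diag[P N] /iwahori_double_anti[P' N'].
have [s0|s0] := leP 0 s; have [s0'|s0'] := ltP 0 s'.
- have [z0 z1 _ _] := P s0; have [z0' z1' _ _] := P' s0'.
  by have := is_order_le z0 z1'; have := is_order_le z0' z1; lia.
- have [z0 _ z1 _] := P s0; have [z0' z1' _ _] := N' s0'.
  by have := is_order_le z0 z1'; have := is_order_le z0' z1; lia.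
- have [z0 _ _ z1] := N s0; have [z0' _ _ z1'] := P' s0'.
  by have := is_order_le z0 z1'; have := is_order_le z0' z1; lia.
- have [z0 _ z1 _] := N s0; have [z0' _ _ z1'] := N' s0'.
  by have := is_order_le z0 z1'; have := is_order_le z0' z1; lia.
Qed.

End Matrices2.

(** * The affine Weyl group of SL_2 as classes of monomial matrices *)

Section AffineWeylGroup.
Variable K : fieldType.
Local Notation L := (laurent K).
Implicit Types (n h x y z : 'M[L]_2) (w : set 'M[L]_2).

Lemma torus_o_sl2P h :
  (@torus_o K `&` @sl2 K) h <-> exists2 u : L, is_order u 0 & h = mx2 u 0 0 u^-1.
Proof.
split=> [[[[_ [h01 h10]] [u0 _]] dh]|[u u0 ->]].
  exists (h 0 0) => //; move: dh; rewrite [h]mx2E h01 h10 /sl2 /= det_mx2 mulr0 subr0.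
  move=> dh; congr mx2; first by rewrite mxE.
  rewrite mxE /=; apply: (mulfI (is_order_neq0 u0)).
  by rewrite dh mulfV // (is_order_neq0 u0).
have un0 := is_order_neq0 u0; have [e1 e2 e3 e4] := mx2_entries u 0 0 u^-1.
have du : \det (mx2 u 0 0 u^-1) = 1 by rewrite det_mx2 mulr0 subr0 mulfV.
split; last exact: du.
split; first by split; [apply/gl2E; rewrite du oner_neq0 | rewrite e2 e3].
by rewrite e1 e4; split=> //; exact: is_orderV u0.
Qed.

Lemma Wclass_refl n : Wclass n n.
Proof.
by exists 1%:M; rewrite ?mulmx1 //; split; [exact: torus_o1 | rewrite /sl2 /= det1].
Qed.

Lemma mx2_diagM (a d a' d' : L) :
  mx2 a 0 0 d *m mx2 a' 0 0 d' = mx2 (a * a') 0 0 (d * d').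
Proof. by rewrite mx2M !(mul0r, mulr0, add0r, addr0). Qed.

Lemma Wclass_mulr n (u : L) : is_order u 0 -> Wclass (n *m mx2 u 0 0 u^-1) = Wclass n.
Proof.
move=> u0; have un0 := is_order_neq0 u0; apply/seteqP; split=> _ [h /torus_o_sl2P[v v0 ->] <-].
  exists (mx2 (u * v) 0 0 (u * v)^-1).
    by apply/torus_o_sl2P; exists (u * v) => //; exact: is_orderM u0 v0.
  by rewrite -mulmxA mx2_diagM invfM.
exists (mx2 (u^-1 * v) 0 0 (u^-1 * v)^-1).
  by apply/torus_o_sl2P; exists (u^-1 * v) => //; exact: is_orderM (is_orderV u0) v0.
by rewrite -mulmxA mx2_diagM invfM invrK mulVKf // mulKf.
Qed.

Lemma Wa_cases w : Wa K w ->
  exists s, w = Wclass (wdiag K s) \/ w = Wclass (wanti K s).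
Proof.
move=> [n [dn nT] <-].
(* One test element of the torus suffices: the eigenvalues t and t^-1 differ, so each row of n,
   being scaled by a single [y0] or [y1], has a zero entry. *)
have [y0 [y1 E]] : exists y0 y1 : L, n *m mx2 (t^1) 0 0 (t^(-1)) = mx2 y0 0 0 y1 *m n.
  have tP : (@torus K `&` @sl2 K) (mx2 (t^1) 0 0 (t^(-1)) : 'M[L]_2).
    have dt : \det (mx2 (t^1) 0 0 (t^(-1)) : 'M[L]_2) = 1.
      by rewrite det_mx2 mulr0 subr0 -monoD.
    split=> //; split; first by apply/gl2E; rewrite dt oner_neq0.
    by rewrite !mxE.
  have : (@torus K `&` @sl2 K) (n *m mx2 (t^1) 0 0 (t^(-1)) *m invmx n).
    by rewrite -nT; exists (mx2 (t^1) 0 0 (t^(-1))).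
  have nu : n \in unitmx by apply/gl2E; rewrite dn oner_neq0.
  move=> [[_ [y01 y10]] _].
  exists ((n *m mx2 (t^1) 0 0 (t^(-1)) *m invmx n) 0 0).
  exists ((n *m mx2 (t^1) 0 0 (t^(-1)) *m invmx n) 1 1).
  by rewrite -[LHS](mulmxKV nu) [in LHS](mx2E (_ *m invmx n)) y01 y10.
have tt : t^1 != t^(-1) :> L.
  apply/negP => /eqP e; have := is_order_mono K 1; rewrite e.
  by move/is_order_inj/(_ (is_order_mono K _)).
move: dn E; rewrite [n]mx2E /sl2 /= det_mx2 !mx2M.
move: (n 0 0) (n 0 1) (n 1 0) (n 1 1) => a b c d dn.
rewrite !(mulr0, mul0r, addr0, add0r) => /mx2_inj[ea eb ec ed].
have split_ (y u v : L) : u * t^1 = y * u -> v * t^(-1) = y * v -> u = 0 \/ v = 0 :> L.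
  have [->|u0] := eqVneq u 0; first by left.
  rewrite mulrC => /(mulIf u0)<-; rewrite mulrC.
  by have [->|v0] := eqVneq v 0; [right | move/(mulIf v0)/esym/eqP; rewrite (negbTE tt)].
have inv (u v : L) : u * v = 1 -> exists m, is_order (u : L) m /\ v = u^-1.
  move=> uv; have u0 : u != 0 by apply: contra_eq_neq uv => ->; rewrite mul0r eq_sym oner_neq0.
  by exists (vL u); split; [exact: is_order_vL | apply: (mulfI u0); rewrite uv mulfV].
case: (split_ _ _ _ ea eb) => [a0|b0]; case: (split_ _ _ _ ec ed) => [c0|d0]; subst.
- by move/eqP: dn; rewrite !(mul0r, mulr0) subr0 eq_sym oner_eq0.
(* The entry b has order m; its unit part is absorbed into the class, which leaves s = - m. *)
- move: dn; rewrite !mul0r sub0r -mulrN => /inv[m [bm cE]].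
  exists (- m); right; rewrite -(@Wclass_mulr (wanti K (- m)) (t^m * b^-1)); last first.
    by apply: (is_orderM_eq (is_order_mono K m) (is_orderV bm)); lia.
  congr Wclass; rewrite mx2M !(mul0r, mulr0, add0r, addr0) opprK; congr mx2.
    by rewrite invfM invrK mulrA mulfV ?mono_neq0 // mul1r.
  by rewrite monoN -[c]opprK cE mulrA mulNr mulVf ?mono_neq0 // mulN1r.
- move: dn; rewrite !mul0r subr0 => /inv[m [am ->]].
  exists (- m); left; rewrite -(@Wclass_mulr (wdiag K (- m)) (t^(- m) * a)); last first.
    by apply: (is_orderM_eq (is_order_mono K (- m)) am); lia.
  congr Wclass; rewrite mx2M !(mul0r, mulr0, add0r, addr0) opprK; congr mx2.
    by rewrite mulrA -monoD subrr mul1r.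
  by rewrite invfM -!monoN opprK mulrA -monoD addNr mul1r.
- by move/eqP: dn; rewrite !(mul0r, mulr0) subr0 eq_sym oner_eq0.
Qed.

Lemma Wclass_wdiag_inj s s' : Wclass (wdiag K s) = Wclass (wdiag K s') -> s = s'.
Proof.
move=> e; have := Wclass_refl (wdiag K s); rewrite e => -[h /torus_o_sl2P[u u0 ->]].
rewrite mx2M !(mul0r, mulr0, add0r, addr0) => /mx2_inj[/esym es _ _ _].
have := is_orderM (is_order_mono K (- s')) u0; rewrite -es.
by move/is_order_inj/(_ (is_order_mono K _)); lia.
Qed.

Lemma Wclass_wdiag_wanti s s' : Wclass (wdiag K s) <> Wclass (wanti K s').
Proof.
move=> e; have := Wclass_refl (wdiag K s); rewrite e => -[h /torus_o_sl2P[u u0 ->]].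
rewrite mx2M !(mul0r, mulr0, add0r, addr0) => /mx2_inj[/esym/eqP].
by rewrite (negbTE (mono_neq0 _ _)).
Qed.

Lemma wlength_wdiag s : wlength (Wclass (wdiag K s)) = absz (2 * s)%R.
Proof.
apply: xget_unique; first by exists s; left.
move=> l [s' [[/Wclass_wdiag_inj<- //]|[/Wclass_wdiag_wanti //]]].
Qed.

End AffineWeylGroup.

(** Cocycle rule: with tau multiplicative, the position of X Y is Y^-1 (X^-1 tau(X)) tau(Y). Here S
    and T stand for the Frobenius images of X and Y. *)
Lemma mulmx_twist (F : fieldType) m (X Y S T B A N C : 'M[F]_m) :
    X \in unitmx -> Y \in unitmx -> B \in unitmx ->
    invmx X *m B *m S *m invmx B = A *m N *m C ->
  X *m Y *m (invmx Y *m A *m N *m (C *m (B *m T *m invmx B))) =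
  B *m (S *m T) *m invmx B.
Proof.
move=> Xu Yu Bu E; rewrite !mulmxA mulmxK // -(mulmxA X) -(mulmxA X) -E.
by rewrite !mulmxA mulmxV // mul1mx mulmxKV.
Qed.

(** The hypothesis on G says tau(G) = G: the group J consists of the fixed points of tau, so left
    translation by it preserves relative positions. *)
Lemma mulmx_twistJ (F : fieldType) m (X G S T B : 'M[F]_m) :
    X \in unitmx -> G \in unitmx -> invmx G *m B *m T = B ->
  G *m X *m (invmx X *m B *m S *m invmx B) = B *m (T *m S) *m invmx B.
Proof.
move=> Xu Gu E; rewrite !mulmxA mulmxK //; congr (_ *m _ *m _).
by rewrite -{1}E !mulmxA mulmxV // mul1mx.
Qed.

(** * Schubert cells *)

Section Cells.
Variables (k : finFieldType) (K : fieldType) (iota : {rmorphism k -> K}).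
Local Notation L := (laurent K).
Local Notation sigma := (map_mx (frob k (K := K))).
Implicit Types (g i j n x y z : 'M[L]_2) (w : set 'M[L]_2) (o up : bool) (h s : int).

Lemma frob_mxM x y : sigma (x *m y) = sigma x *m sigma y.
Proof.
by rewrite [x]mx2E [y]mx2E mx2M !map_mx2 mx2M !(frobD iota) !(frobM iota).
Qed.

Lemma iwahori_frob i : iwahori i -> iwahori (sigma i).
Proof.
rewrite [i]mx2E map_mx2 => /iwahori_mx2[a b c d]; apply/iwahori_mx2.
by split; [exact: is_order_frob | exact: val_ge_frob | exact: val_ge_frob
  | exact: is_order_frob].
Qed.

(* The relative position of x I and tau (x I), where tau = b1 sigma(.) b1^-1. *)
Definition twist x : 'M[L]_2 := invmx x *m b1 K *m sigma x *m invmx (b1 K).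

Lemma twist_eq x y : x \in unitmx ->
  x *m y = b1 K *m sigma x *m invmx (b1 K) -> twist x = y.
Proof.
move=> xu E; rewrite /twist -(mulmxA (invmx x)) -(mulmxA (invmx x)).
by rewrite -E mulKmx. Qed.

Lemma twist_iwahori x i n : x \in unitmx -> iwahori i ->
  iwahori_double n (twist x) -> iwahori_double n (twist (x *m i)).
Proof.
move=> xu Ii [a [c [Ia Ic E]]].
exists (invmx i *m a), (c *m (b1 K *m sigma i *m invmx (b1 K))); split.
- by apply: iwahoriM Ia; apply: iwahoriV.
- by apply: iwahoriM Ic _; apply/iwahori_conj_b1/iwahori_frob.
have iu : i \in unitmx by exact: iwahori_gl2.
apply: twist_eq; first by rewrite unitmx_mul xu.
rewrite frob_mxM; exact: mulmx_twist xu iu (b1_gl2 K) E.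
Qed.

Lemma twist_Jgroup g x : Jgroup k (b1 K) g -> x \in unitmx ->
  twist (g *m x) = twist x.
Proof.
move=> [gu gb] xu; apply: twist_eq; first by rewrite unitmx_mul gu.
by rewrite frob_mxM; apply: mulmx_twistJ.
Qed.

Lemma ADL_GL_twist n c :
  ADL_GL k (Wclass n) (b1 K) c <->
  exists x, [/\ gl2 x, c = lcoset x (@iwahori K) & iwahori_double n (twist x)].
Proof.
by split=> -[x [xu cE h]]; exists x; split=> //; move: h;
   rewrite vL_det_b1 => /double_coset_Wtilde.
Qed.

Lemma ADL_SL_twist n c :
  ADL_SL k (Wclass n) (b1 K) c <->
  exists x, [/\ sl2 x, c = lcoset x (@iwahori K `&` @sl2 K)
              & iwahori_double n (twist x)].
Proof.
by split=> -[x [xu cE h]]; exists x; split=> //; move: h;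
   rewrite vL_det_b1 => /double_coset_Wtilde.
Qed.

(* For s = 2 h + o (= parity o h), the points of X_w(b1), w the class of
   diag(t^-s, t^s), are the x I with x = uni up b *m cellv o h, where b lies in
   t^(eps up) o and up = uptype o h. *)
Definition uni up (b : L) : 'M[L]_2 := if up then mx2 1 b 0 1 else mx2 1 0 b 1.
(** As (o, h) varies, v = [cellv] meets every class of W_a once, with length the absolute value of s
    = [parity o h]. Up to sign, v^-1 b1 v b1^-1 is diag(t^-s, t^s). *)
Definition cellv o h : 'M[L]_2 := if o then wanti K (h + 1) else wdiag K (- h).
(** Unipotents of I of the opposite type are conjugated into I by v, so they fix the chamber v I.
    For o = false and h = 0 the cell is a point and the value is a convention. *)
Definition uptype o h : bool := if o then h < 0 else 0 <= h.
Definition eps up : int := (~~ up : nat)%:Z.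
Definition parity o h : int := h + h + (o : nat)%:Z.

Lemma uni_unit up b : uni up b \in unitmx.
Proof.
by case: up; apply/gl2E; rewrite det_mx2 ?(mul0r, mulr0) mul1r subr0 oner_neq0.
Qed.

Lemma det_cellv o h : \det (cellv o h) = 1.
Proof.
by case: o; rewrite det_mx2 ?(mul0r, mulr0) ?mulrN ?sub0r ?subr0 ?opprK -monoD ?opprK
  ?addNr ?subrr.
Qed.

Lemma det_uni up b : \det (uni up b) = 1.
Proof. by case: up; rewrite det_mx2 ?(mul0r, mulr0) mul1r subr0. Qed.

Lemma cellv_unit o h : cellv o h \in unitmx.
Proof. by apply/gl2E; rewrite det_cellv oner_neq0. Qed.

Lemma is_order_1B b : val_ge 1 b -> is_order (1 - b : L) 0.
Proof. by move=> b1; apply: (is_orderDl (m := 0)) (is_order1 K) (val_geN b1). Qed.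

Lemma twist_cell_factor x i j s :
    x \in unitmx -> iwahori i -> iwahori j ->
    x *m (i *m wdiag K s *m j) = b1 K *m sigma x *m invmx (b1 K) ->
  iwahori_double (wdiag K s) (twist x).
Proof. by move=> xu Ii Ij /(twist_eq xu)->; exists i, j. Qed.

(** Conjugation by b1 exchanges upper and lower unipotents. Hence x^-1 tau(x) = v^-1 u(-b) u'(c)
    tau(v) with u' of the opposite type and c = t sigma(b) or t^-1 sigma(b). Gauss elimination
    rewrites u(-b) u'(c) as opposite type, diagonal, original type; moving the outer factors past v
    and tau(v) puts them into I. The explicit witnesses below are these conjugates, with the
    diagonal part in the left one. *)
Lemma twist_cell o h (b : L) : val_ge (eps (uptype o h)) b ->
  iwahori_double (wdiag K (parity o h)) (twist (uni (uptype o h) b *m cellv o h)).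
Proof.
have T0 := mono_neq0 K h; have t0 := mono_neq0 K 1.
have xu : uni (uptype o h) b *m cellv o h \in unitmx.
  by rewrite unitmx_mul uni_unit cellv_unit.
move: xu; rewrite /cellv /uni /parity /uptype /wdiag /wanti /eps.
case: o => /=; [case: (ltP h 0) | case: (leP 0 h)] => hs;
  rewrite ?opprK ?addr0 /= => xu b0; have fb0 := val_ge_frob k b0.
(* u is the pivot 1 - b c. In the upper type c gains a factor t; in the lower type b and its
   Frobenius image have valuation at least 1 and c loses one factor. Either way b c has positive
   valuation. *)
- have [u uE] : exists u, u = 1 - b * (t^1 * frob k b) by eexists.
  have uo : is_order u 0.
    rewrite uE; apply: is_order_1B.
    by apply: (val_geM_le b0 (val_geM (@val_ge_mono _ 1 1) fb0)); lia.
  have u0 := is_order_neq0 uo; have uV := is_orderV uo.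
  apply: (@twist_cell_factor _ (mx2 (- u^-1) (frob k b * t^(- (h + h + 1))) 0 (- u))
            (mx2 1 0 (t^1 * b * t^(- (h + h + 1)) * u^-1) 1)) => //.
  + apply/iwahori_mx2; split=> //; try exact: is_orderN.
    by apply: (val_geM_le fb0 (@val_ge_mono _ 1 _)); lia.
  + have vt := @val_ge_mono K 1 1; have vA := @val_ge_mono K 1 (- (h + h + 1)).
    by apply/iwahori_lower/(val_geM_le (val_geM3 vt b0 vA (lexx _)) (is_order_ge uV)); lia.
  + rewrite frob_mxM !map_mx2 ?(frobN iota) !frob_mono ?(frob0 k) ?frob1.
    rewrite [X in b1 K *m X *m _]mx2M conj_b1 !mx2M !(mul0r, mulr0, mul1r, mulr1, add0r, addr0).
    rewrite !(monoN, monoD).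
    rewrite ?monoN in uE; clear uo xu b0 fb0 uV.
    move: (frob k b) (t^h) (t^1) T0 t0 u0 uE => fb T t1 T0 t0 u0 uE.
    by subst u; congr mx2; field; rewrite ?T0 ?t0 ?u0.
- have [u uE] : exists u, u = 1 - b * (t^(-1) * frob k b) by eexists.
  have uo : is_order u 0.
    rewrite uE; apply: is_order_1B.
    by apply: (val_geM_le b0 (val_geM (@val_ge_mono _ 1 (-1)) fb0)); lia.
  have u0 := is_order_neq0 uo; have uV := is_orderV uo.
  apply: (@twist_cell_factor _ (mx2 (- u) 0 (frob k b * t^(h + h + 1)) (- u^-1))
            (mx2 1 (b * t^(h + h + 1) * t^(-1) * u^-1) 0 1)) => //.
  + apply/iwahori_mx2; split=> //; try exact: is_orderN.
    by apply: (val_geM_le fb0 (@val_ge_mono _ 1 _)); lia.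
  + have vt := @val_ge_mono K 1 (-1); have vA := @val_ge_mono K 1 (h + h + 1).
    by apply/iwahori_upper/(val_geM_le (val_geM3 b0 vA vt (lexx _)) (is_order_ge uV)); lia.
  + rewrite frob_mxM !map_mx2 ?(frobN iota) !frob_mono ?(frob0 k) ?frob1.
    rewrite [X in b1 K *m X *m _]mx2M conj_b1 !mx2M !(mul0r, mulr0, mul1r, mulr1, add0r, addr0).
    rewrite !(monoN, monoD).
    rewrite ?monoN in uE; clear uo xu b0 fb0 uV.
    move: (frob k b) (t^h) (t^1) T0 t0 u0 uE => fb T t1 T0 t0 u0 uE.
    (* [field] clears the denominator t and therefore meets the pivot in the form t u. *)
    have u1 : t1 - b * fb != 0.
      have -> : t1 - b * fb = t1 * u by rewrite uE; field.
      exact: mulf_neq0.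
    by subst u; congr mx2; field; rewrite ?T0 ?t0 ?u1.
- have [u uE] : exists u, u = 1 - b * (t^1 * frob k b) by eexists.
  have uo : is_order u 0.
    rewrite uE; apply: is_order_1B.
    by apply: (val_geM_le b0 (val_geM (@val_ge_mono _ 1 1) fb0)); lia.
  have u0 := is_order_neq0 uo; have uV := is_orderV uo.
  apply: (@twist_cell_factor _ (mx2 u 0 (t^1 * frob k b * t^(h + h)) u^-1)
            (mx2 1 (- b * t^(h + h) * u^-1) 0 1)) => //.
  + apply/iwahori_mx2; split=> //; try exact: is_orderN.
    by apply: (val_geM3 (@val_ge_mono _ 1 1) fb0 (@val_ge_mono _ 1 _)); lia.
  + apply: iwahori_upper.
    by apply: (val_geM3 (val_geN b0) (@val_ge_mono _ 1 _) (is_order_ge uV)); lia.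
  + rewrite frob_mxM !map_mx2 ?(frobN iota) !frob_mono ?(frob0 k) ?frob1.
    rewrite [X in b1 K *m X *m _]mx2M conj_b1 !mx2M !(mul0r, mulr0, mul1r, mulr1, add0r, addr0).
    rewrite !(monoN, monoD).
    rewrite ?monoN in uE; clear uo xu b0 fb0 uV.
    move: (frob k b) (t^h) (t^1) T0 t0 u0 uE => fb T t1 T0 t0 u0 uE.
    by subst u; congr mx2; field; rewrite ?T0 ?t0 ?u0.
- have [u uE] : exists u, u = 1 - b * (t^(-1) * frob k b) by eexists.
  have uo : is_order u 0.
    rewrite uE; apply: is_order_1B.
    by apply: (val_geM_le b0 (val_geM (@val_ge_mono _ 1 (-1)) fb0)); lia.
  have u0 := is_order_neq0 uo; have uV := is_orderV uo.
  apply: (@twist_cell_factor _ (mx2 u^-1 (t^(-1) * frob k b * t^(- (h + h))) 0 u)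
            (mx2 1 0 (- b * t^(- (h + h)) * u^-1) 1)) => //.
  + apply/iwahori_mx2; split=> //; try exact: is_orderN.
    by apply: (val_geM3 (@val_ge_mono _ 1 _) fb0 (@val_ge_mono _ 1 _)); lia.
  + apply: iwahori_lower.
    by apply: (val_geM3 (val_geN b0) (@val_ge_mono _ 1 _) (is_order_ge uV)); lia.
  + rewrite frob_mxM !map_mx2 ?(frobN iota) !frob_mono ?(frob0 k) ?frob1.
    rewrite [X in b1 K *m X *m _]mx2M conj_b1 !mx2M !(mul0r, mulr0, mul1r, mulr1, add0r, addr0).
    rewrite !(monoN, monoD).
    rewrite ?monoN in uE; clear uo xu b0 fb0 uV.
    move: (frob k b) (t^h) (t^1) T0 t0 u0 uE => fb T t1 T0 t0 u0 uE.
    have u1 : t1 - b * fb != 0.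
      have -> : t1 - b * fb = t1 * u by rewrite uE; field.
      exact: mulf_neq0.
    by subst u; congr mx2; field; rewrite ?T0 ?t0 ?u1.
Qed.

End Cells.

(** * Schubert cells exhaust the determinants of order zero *)

Section CellDecomposition.
Variable K : fieldType.
Local Notation L := (laurent K).
Implicit Types (g i j n x y z : 'M[L]_2) (o up : bool) (h s m : int).

Lemma uniD up (a b : L) : uni up (a + b) = uni up a *m uni up b.
Proof.
by case: up; rewrite mx2M !(mul0r, mulr0, mul1r, mulr1, add0r, addr0) // addrC.
Qed.

(** Conjugation by [cellv] takes an entry of exactly this valuation to the least valuation that I
    allows at its place. Thus only [absz (parity o h)] coefficients of b affect the coset, which is
    the dimension of the cell. *)
Lemma uni_cellv o h (b : L) :
    val_ge (eps (uptype o h) + (absz (parity o h))%:Z) b ->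
  exists2 i, iwahori i & uni (uptype o h) b *m cellv K o h = cellv K o h *m i.
Proof.
have T0 := mono_neq0 K h; have t0 := mono_neq0 K 1.
rewrite /cellv /uni /parity /uptype /wdiag /wanti /eps.
case: o => /=; [case: (ltP h 0) | case: (leP 0 h)] => hs;
  rewrite ?opprK ?addr0 /= => b0.
- exists (mx2 1 0 (- (t^(h + 1) * t^(h + 1) * b)) 1).
    apply/iwahori_lower/val_geN.
    by apply: (val_geM3 (@val_ge_mono _ 1 _) (@val_ge_mono _ 1 _) b0); lia.
  rewrite !mx2M !(mul0r, mulr0, mul1r, mulr1, add0r, addr0) !(monoN, monoD).
  move: (t^h) (t^1) T0 t0 => T t1 T0 t0; congr mx2; field; by rewrite T0 t0.
- exists (mx2 1 (- (t^(- (h + 1)) * t^(- (h + 1)) * b)) 0 1).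
    apply/iwahori_upper/val_geN.
    by apply: (val_geM3 (@val_ge_mono _ 1 _) (@val_ge_mono _ 1 _) b0); lia.
  rewrite !mx2M !(mul0r, mulr0, mul1r, mulr1, add0r, addr0) !(monoN, monoD).
  move: (t^h) (t^1) T0 t0 => T t1 T0 t0; congr mx2; field; by rewrite T0 t0.
- exists (mx2 1 (t^(- h) * t^(- h) * b) 0 1).
    apply/iwahori_upper.
    by apply: (val_geM3 (@val_ge_mono _ 1 _) (@val_ge_mono _ 1 _) b0); lia.
  rewrite !mx2M !(mul0r, mulr0, mul1r, mulr1, add0r, addr0) !(monoN, monoD).
  move: (t^h) T0 => T T0; congr mx2; by field; rewrite T0.
- exists (mx2 1 0 (t^h * t^h * b) 1).
    apply/iwahori_lower.
    by apply: (val_geM3 (@val_ge_mono _ 1 _) (@val_ge_mono _ 1 _) b0); lia.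
  rewrite !mx2M !(mul0r, mulr0, mul1r, mulr1, add0r, addr0) !(monoN, monoD).
  move: (t^h) T0 => T T0; congr mx2; by field; rewrite T0.
Qed.

Lemma mulmx2_entry p q (x : 'M[L]_(p, 2)) (y : 'M[L]_(2, q)) r c :
  (x *m y) r c = x r 0 * y 0 c + x r 1 * y 1 c.
Proof.
rewrite mxE !big_ord_recl big_ord0 addr0.
by have -> : lift ord0 ord0 = 1 :> 'I_2 by apply: val_inj.
Qed.

(** Column elimination within I. A tie of valuations must be resolved in favour of column 0:
    clearing column 1 uses an upper unipotent with integral entry, whereas clearing column 0 needs a
    multiplier in the maximal ideal. *)
Lemma row_reduce x (r : 'I_2) : x r 0 != 0 \/ x r 1 != 0 ->
  exists g m, iwahori g /\
    (((x *m g) r 0 = 0 /\ is_order ((x *m g) r 1) m) \/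
     (is_order ((x *m g) r 0) m /\ (x *m g) r 1 = 0)).
Proof.
have I1 := iwahori1 K; set c := x r 0; set d := x r 1.
have [c0|c0] := eqVneq c 0.
  case=> [//|d0]; exists 1%:M, (vL d); split=> //; left.
  by rewrite mulmx1; split=> //; exact: is_order_vL.
move=> _; have [d0|d0] := eqVneq d 0.
  exists 1%:M, (vL c); split=> //; right.
  by rewrite mulmx1; split=> //; exact: is_order_vL.
have [co do_] := (is_order_vL c0, is_order_vL d0).
have [dc|cd] := ltP (vL d) (vL c).
  exists (mx2 1 0 (- (c / d)) 1), (vL d); split.
    apply/iwahori_lower/val_geN/(val_geM_le (is_order_ge co) (is_order_ge (is_orderV do_))).
    lia.
  left; rewrite !mulmx2_entry !mxE /= -/c -/d mulr0 add0r !mulr1; split=> //.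
  by rewrite mulrN mulrCA mulfV // mulr1 subrr.
exists (mx2 1 (- (d / c)) 0 1), (vL c); split.
  apply/iwahori_upper/val_geN/(val_geM_le (is_order_ge do_) (is_order_ge (is_orderV co))).
  lia.
right; rewrite !mulmx2_entry !mxE /= -/c -/d mulr0 addr0 !mulr1; split=> //.
by rewrite mulrN mulrCA mulfV // mulr1 addNr.
Qed.

Lemma val_ge_row_iwahori x g (r : 'I_2) m :
    iwahori g -> val_ge m (x r 0) -> val_ge m (x r 1) ->
  forall c, val_ge m ((x *m g) r c).
Proof.
rewrite [g]mx2E => /iwahori_mx2[ga gb gc gd] x0 x1.
case=> -[|[|//]] cP; rewrite mulmx2_entry !mxE /=; apply: val_geD.
- by apply: (val_geM_le x0 (is_order_ge ga)); lia.
- by apply: (val_geM_le x1 gc); lia.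
- by apply: (val_geM_le x0 gb); lia.
- by apply: (val_geM_le x1 (is_order_ge gd)); lia.
Qed.

Lemma wdiag_unit s (a d : L) : is_order a (- s) -> is_order d s ->
  exists2 i, iwahori i & mx2 a 0 0 d = wdiag K s *m i.
Proof.
move=> ao do_; exists (mx2 (t^s * a) 0 0 (t^(- s) * d)).
  apply: iwahori_diag.
    by apply: (is_orderM_eq (is_order_mono K s) ao); lia.
  by apply: (is_orderM_eq (is_order_mono K (- s)) do_); lia.
by rewrite mx2_diagM !mulrA -!monoD addNr subrr !mul1r.
Qed.

Lemma wanti_unit s (b c : L) : is_order b (- s) -> is_order c s ->
  exists2 i, iwahori i & mx2 0 b c 0 = wanti K s *m i.
Proof.
move=> bo co; exists (mx2 (- (t^(- s) * c)) 0 0 (t^s * b)).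
  apply: iwahori_diag.
    by apply/is_orderN/(is_orderM_eq (is_order_mono K (- s)) co); lia.
  by apply: (is_orderM_eq (is_order_mono K s) bo); lia.
rewrite mx2M !(mul0r, mulr0, mul1r, mulr1, add0r, addr0) mulrNN !mulrA -!monoD.
by rewrite addNr subrr !mul1r.
Qed.

(** The determinant gives the monomial entry of row 0 the order - m, and the bound on row 0 then
    yields m <= - m. This inequality is the sign condition in [uptype]. *)
Lemma upper_decomposition x m :
    is_order (\det x) 0 -> val_ge m (x 0 0) -> val_ge m (x 0 1) ->
    (x 1 0 = 0 /\ is_order (x 1 1) m) \/ (is_order (x 1 0) m /\ x 1 1 = 0) ->
  exists o h (b : L) i, [/\ uptype o h, val_ge 0 b, iwahori i
    & x = uni true b *m cellv K o h *m i].
Proof.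
rewrite [x]mx2E det_mx2; case: (mx2_entries (x 0 0) (x 0 1) (x 1 0) (x 1 1)) => -> -> -> ->.
move: (x 0 0) (x 0 1) (x 1 0) (x 1 1) => a b c d dx am bm [[z dm]|[cm z]]; subst.
  have d0 := is_order_neq0 dm.
  have ao : is_order a (- m).
    have := is_orderM_eq dx (is_orderV dm) (add0r _).
    by rewrite mulr0 subr0 mulfK.
  have [i Ii E] := wdiag_unit ao dm.
  exists false, (- m), (b / d), i; split=> //.
  - have := is_order_le ao am; rewrite /uptype; lia.
  - by apply: (val_geM_le bm (is_order_ge (is_orderV dm))); lia.
  rewrite /cellv opprK -mulmxA -E mx2M !(mul0r, mulr0, mul1r, mulr1, add0r, addr0).
  by rewrite mulfVK.
have c0 := is_order_neq0 cm.
have bo : is_order b (- m).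
  have := is_orderN (is_orderM_eq dx (is_orderV cm) (add0r _)).
  by rewrite mulr0 sub0r mulNr opprK mulfK.
have [i Ii E] := wanti_unit bo cm.
exists true, (m - 1), (a / c), i; split=> //.
- have := is_order_le bo bm; rewrite /uptype; lia.
- by apply: (val_geM_le am (is_order_ge (is_orderV cm))); lia.
rewrite /cellv subrK -mulmxA -E mx2M !(mul0r, mulr0, mul1r, mulr1, add0r, addr0).
by rewrite mulfVK.
Qed.

Lemma lower_decomposition x m :
    is_order (\det x) 0 -> val_ge (m + 1) (x 1 0) -> val_ge (m + 1) (x 1 1) ->
    (x 0 0 = 0 /\ is_order (x 0 1) m) \/ (is_order (x 0 0) m /\ x 0 1 = 0) ->
  exists o h (b : L) i, [/\ ~~ uptype o h, val_ge 1 b, iwahori i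
    & x = uni false b *m cellv K o h *m i].
Proof.
rewrite [x]mx2E det_mx2; case: (mx2_entries (x 0 0) (x 0 1) (x 1 0) (x 1 1)) => -> -> -> ->.
move: (x 0 0) (x 0 1) (x 1 0) (x 1 1) => a b c d dx cm dm [[z bm]|[am z]]; subst.
  have b0 := is_order_neq0 bm.
  have co : is_order c (- m).
    have := is_orderN (is_orderM_eq dx (is_orderV bm) (add0r _)).
    by rewrite mul0r sub0r mulNr opprK mulrAC mulfV // mul1r.
  rewrite -[m]opprK in bm; have [i Ii E] := wanti_unit bm co; rewrite opprK in bm.
  exists true, (- m - 1), (d / b), i; split=> //.
  - have := is_order_le co cm; rewrite /uptype; lia.
  - by apply: (val_geM_le dm (is_order_ge (is_orderV bm))); lia.
  rewrite /cellv subrK -mulmxA -E mx2M !(mul0r, mulr0, mul1r, mulr1, add0r, addr0).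
  by rewrite mulfVK.
have a0 := is_order_neq0 am.
have do_ : is_order d (- m).
  have := is_orderM_eq dx (is_orderV am) (add0r _).
  by rewrite mul0r subr0 mulrAC mulfV // mul1r.
rewrite -[m]opprK in am; have [i Ii E] := wdiag_unit am do_; rewrite opprK in am.
exists false, m, (c / a), i; split=> //.
- have := is_order_le do_ dm; rewrite /uptype; lia.
- by apply: (val_geM_le cm (is_order_ge (is_orderV am))); lia.
rewrite /cellv -mulmxA -E mx2M !(mul0r, mulr0, mul1r, mulr1, add0r, addr0).
by rewrite mulfVK.
Qed.

Lemma row_neq0 x (r : 'I_2) : \det x != 0 -> x r 0 != 0 \/ x r 1 != 0.
Proof.
move=> dx; have [x0|] := eqVneq (x r 0) 0; last by left.
have [x1|] := eqVneq (x r 1) 0; last by right.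
case/eqP: dx; rewrite (expand_det_row _ r) big1 // => j _.
suff -> : x r j = 0 by rewrite mul0r.
by case: j => -[|[|//]] jP; [rewrite -x0|rewrite -x1]; congr (x r _); apply: val_inj.
Qed.

(** Row 1 is reduced to a pivot of order m. If row 0 has valuation at least m, dividing by the pivot
    gives an integral b and an upper cell. Otherwise row 0 is reduced instead; its pivot has order
    below m, so the quotient by it lies in the maximal ideal and the cell is lower. *)
Lemma cell_decomposition x : is_order (\det x) 0 ->
  exists o h (b : L) i, [/\ val_ge (eps (uptype o h)) b, iwahori i
    & x = uni (uptype o h) b *m cellv K o h *m i].
Proof.
move=> dx; have [g [m [Ig xg]]] := row_reduce (row_neq0 1 (is_order_neq0 dx)).
have dxg : is_order (\det (x *m g)) 0.
  by rewrite det_mulmx; apply: (is_orderM_eq dx (det_iwahori Ig)).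
have gu : g \in unitmx by exact: iwahori_gl2.
have [y0m|y0m] := pselect (val_ge m ((x *m g) 0 0) /\ val_ge m ((x *m g) 0 1)).
  have [o [h [b [i [up b0 Ii E]]]]] := upper_decomposition dxg y0m.1 y0m.2 xg.
  exists o, h, b, (i *m invmx g); rewrite up; split=> //.
    by apply: iwahoriM => //; exact: iwahoriV.
  by rewrite mulmxA -E mulmxK.
have ym : val_ge m ((x *m g) 1 0) /\ val_ge m ((x *m g) 1 1).
  by case: xg => -[]; [move=> -> [_ ?] | move=> [_ ?] ->].
have [g' [m' [Ig' xg']]] := row_reduce (row_neq0 0 (is_order_neq0 dxg)).
have gu' : g' \in unitmx by exact: iwahori_gl2.
have dxg' : is_order (\det (x *m g *m g')) 0.
  by rewrite det_mulmx; apply: (is_orderM_eq dxg (det_iwahori Ig')).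
(* If m <= m', the bound m on the reduced row 0 would go back to the original row 0 through the
   inverse of g', against the case assumption. *)
have mm' : m' < m.
  rewrite ltNge; apply/negP => m_le; apply: y0m.
  have row0 : val_ge m ((x *m g *m g') 0 0) /\ val_ge m ((x *m g *m g') 0 1).
    case: xg' => -[]; [move=> -> [_ h] | move=> [_ h] ->]; split=> //; exact: val_geW m_le h.
  have h := @val_ge_row_iwahori (x *m g *m g') _ 0 m (iwahoriV Ig') row0.1 row0.2.
  by split; [move: (h 0) | move: (h 1)]; rewrite mulmxK.
have row1 c : val_ge (m' + 1) ((x *m g *m g') 1 c).
  by apply: (val_geW _ (@val_ge_row_iwahori (x *m g) g' 1 m Ig' ym.1 ym.2 c)); lia.
have [o [h [b [i [up b0 Ii E]]]]] := lower_decomposition dxg' (row1 0) (row1 1) xg'.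
exists o, h, b, (i *m invmx g' *m invmx g); rewrite (negbTE up); split=> //.
  by apply: iwahoriM (iwahoriV Ig); apply: iwahoriM (iwahoriV Ig').
by rewrite !mulmxA -E !mulmxK.
Qed.

Definition cell o h d (p : 'I_d -> K) : 'M[L]_2 :=
  uni (uptype o h) (lpoly (eps (uptype o h)) p) *m cellv K o h.

Lemma cell_unit o h d (p : 'I_d -> K) : cell o h p \in unitmx.
Proof. by rewrite unitmx_mul uni_unit cellv_unit. Qed.

Lemma det_cell o h d (p : 'I_d -> K) : \det (cell o h p) = 1.
Proof. by rewrite det_mulmx det_uni det_cellv mulr1. Qed.

Lemma cell_exists x : is_order (\det x) 0 ->
  exists o h (p : 'I_(absz (parity o h)) -> K) i,
    iwahori i /\ x = cell o h p *m i.
Proof.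
move=> /cell_decomposition[o [h [b [i [b0 Ii ->]]]]].
(* b is truncated to its first [absz (parity o h)] coefficients; the tail moves past [cellv] into
   I. *)
have [p bp] := lpoly_approx (absz (parity o h)) b0.
have [j Ij E] := uni_cellv bp.
exists o, h, p, (j *m i); split; first exact: iwahoriM.
rewrite /cell mulmxA; congr (_ *m i); rewrite -mulmxA -E mulmxA -uniD.
by rewrite [lpoly _ _ + _]addrC subrK.
Qed.

End CellDecomposition.

(** * Morphisms of k-spaces *)

Section KMorphisms.
Variables (k K : fieldType) (iota : {rmorphism k -> K}).

HB.instance Definition _ (I : finType) (a : I -> K) :=
  GRing.RMorphism.copy (@peval k K iota I a) (mmap iota (fun i => a (enum_val i))).

Section Fractions.
Variables (I : finType) (Q : mpoly #|I| k).

(** Regular functions on the locus where Q does not vanish. The exponent is left free so that sums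
    and products need no homogenization; only the nonvanishing of Q matters afterwards. *)
Definition fraction (f : (I -> K) -> K) : Prop :=
  exists N (P : mpoly #|I| k), forall a, peval iota a Q != 0 ->
    f a = peval iota a P / peval iota a Q ^+ N.

Lemma fraction_const c : fraction (fun=> iota c).
Proof.
by exists 0, (mpolyC #|I| c) => a _; rewrite /peval mmapC expr0 divr1.
Qed.

Lemma fractionD f g : fraction f -> fraction g -> fraction (fun a => f a + g a).
Proof.
move=> [N [P fE]] [M [R gE]]; exists (N + M)%N, (P * Q ^+ M + R * Q ^+ N) => a Qa.
by rewrite fE // gE // rmorphD !rmorphM !rmorphXn exprD /=; field; rewrite !expf_neq0.
Qed.

Lemma fractionM f g : fraction f -> fraction g -> fraction (fun a => f a * g a).
Proof.
move=> [N [P fE]] [M [R gE]]; exists (N + M)%N, (P * R) => a Qa.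
by rewrite fE // gE // rmorphM exprD /=; field; rewrite !expf_neq0.
Qed.

Lemma fraction_big (T : Type) (r : seq T) (F : T -> (I -> K) -> K) :
  (forall i, fraction (F i)) ->
  fraction (fun a => \sum_(i <- r) F i a) /\ fraction (fun a => \prod_(i <- r) F i a).
Proof.
move=> FF; elim: r => [|i r [IHs IHp]]; split.
- have -> : (fun a => \sum_(i <- [::]) F i a) = (fun=> iota 0).
    by apply/funext => a; rewrite big_nil rmorph0.
  exact: fraction_const.
- have -> : (fun a => \prod_(i <- [::]) F i a) = (fun=> iota 1).
    by apply/funext => a; rewrite big_nil rmorph1.
  exact: fraction_const.
- under eq_fun do rewrite big_cons; exact: fractionD.
- under eq_fun do rewrite big_cons; exact: fractionM.
Qed.

Lemma fractionX f n : fraction f -> fraction (fun a => f a ^+ n).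
Proof.
move=> Ff; elim: n => [|n IH].
  by under eq_fun do rewrite expr0 -(rmorph1 iota); exact: fraction_const.
by under eq_fun do rewrite exprS; exact: fractionM.
Qed.

Lemma fraction_peval (J : finType) (P : J -> mpoly #|I| k) (R : mpoly #|J| k) :
  fraction (fun a => peval iota (fun v => peval iota a (P v) / peval iota a Q) R).
Proof.
rewrite /peval /mmap; apply: (proj1 (fraction_big _ _)) => m.
apply: fractionM; first exact: fraction_const.
apply: (proj2 (fraction_big _ _)) => j; apply: fractionX.
by exists 1%N, (P (enum_val j)) => a _; rewrite expr1.
Qed.

End Fractions.

(* Maps given, near every point and in some chart of the target, by quotients
   of polynomials over k in the coordinates of any given chart of the source. *)
Definition kmorph (X Y : kspace K) (f : kpt X -> kpt Y) : Prop :=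
  forall p, @kcar K X p -> @kcar K Y (f p) /\
    forall i a, @kcoord K X i p a ->
      exists (j : kidx Y) (Q : mpoly #|kvars i| k) (P : kvars j -> mpoly #|kvars i| k),
        peval iota a Q != 0 /\
        forall p' a', @kcar K X p' -> @kcoord K X i p' a' -> peval iota a' Q != 0 ->
          @kcoord K Y j (f p') (fun v => peval iota a' (P v) / peval iota a' Q).

Variables X Y : kspace K.

Lemma kmorph_open f (V : set (kpt Y)) :
  @kmorph X Y f -> kopen iota V -> kopen iota (kpreim f V).
Proof.
move=> fm [VY Vo]; split=> [p []//|p i a [pX fV] pa].
have [_ /(_ i a pa)[j [Q [P [Qa QP]]]]] := fm p pX.
have [R [Ra RV]] := Vo _ _ _ fV (QP _ _ pX pa Qa).
have [N [S SE]] := fraction_peval Q P R.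
exists (S * Q); split=> [|p' a' p'X p'a']; rewrite rmorphM /=.
  rewrite mulf_neq0 //; apply: contra Ra => /eqP S0.
  by rewrite SE // S0 mul0r.
rewrite mulf_eq0 negb_or => /andP[Sa' Qa']; split=> //.
apply: RV (QP _ _ p'X p'a' Qa') _; first by have [] := fm p' p'X.
by rewrite SE // mulf_neq0 // invr_neq0 // expf_neq0.
Qed.

Lemma kmorph_regular f (V : set (kpt Y)) h :
  @kmorph X Y f -> kregular iota V h -> kregular iota (kpreim f V) (h \o f).
Proof.
move=> fm Vh p i a [pX fV] pa.
have [_ /(_ i a pa)[j [Q [P [Qa QP]]]]] := fm p pX.
have [R1 [R2 [R2a RV]]] := Vh _ _ _ fV (QP _ _ pX pa Qa).
have [N1 [S1 S1E]] := fraction_peval Q P R1.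
have [N2 [S2 S2E]] := fraction_peval Q P R2.
(* The quotient of S1 / Q^N1 by S2 / Q^N2. The extra factor Q makes nonvanishing of the denominator
   imply that of Q even when N1 = 0. *)
exists (S1 * Q ^+ N2.+1), (S2 * Q ^+ N1.+1).
split=> [|p' a' [p'X fV'] p'a']; rewrite !rmorphM !rmorphXn /=.
  rewrite mulf_neq0 ?expf_neq0 //; apply: contra R2a => /eqP S0.
  by rewrite S2E // S0 mul0r.
rewrite mulf_eq0 negb_or expf_eq0 /= => /andP[Sa' Qa'].
rewrite (RV _ _ fV' (QP _ _ p'X p'a' Qa')); last first.
  by rewrite S2E // mulf_neq0 // invr_neq0 // expf_neq0.
rewrite S1E // S2E // !exprS; field.
by rewrite Sa' Qa' !expf_neq0.
Qed.

Lemma kpreimK (A B : kspace K) (f : kpt A -> kpt B) (g : kpt B -> kpt A) V :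
  (forall q, @kcar K B q -> @kcar K A (g q)) -> (forall q, @kcar K B q -> f (g q) = q) ->
  V `<=` @kcar K B -> kpreim g (kpreim f V) = V.
Proof.
move=> gA gK VB; apply/seteqP; split=> q.
  by move=> [qB [_ /=]]; rewrite gK.
by move=> Vq; have qB := VB _ Vq; split=> //; split; [exact: gA|rewrite /= gK].
Qed.

End KMorphisms.

Section KIsomorphisms.
Variables (k K : fieldType) (iota : {rmorphism k -> K}).

Lemma kmorph_kiso (X Y : kspace K) (f : kpt X -> kpt Y) (g : kpt Y -> kpt X) :
    kmorph iota f -> kmorph iota g ->
    (forall p, @kcar K X p -> g (f p) = p) -> (forall q, @kcar K Y q -> f (g q) = q) ->
  is_kiso iota f.
Proof.
move=> fm gm fK gK.
have gX q : @kcar K Y q -> @kcar K X (g q) by move=> /gm[].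
split.
- split=> [p /fm[]//|p q /set_mem pX /set_mem qX e|q qY].
    by rewrite -(fK p) // e fK.
  by exists (g q); [exact: gX | exact: gK].
- move=> V VY; split=> [|Vo]; first exact: kmorph_open.
  by rewrite -(kpreimK gX gK VY); apply: kmorph_open.
(* Regularity descends by pulling back once more along g, because h, f and g compose to h on V. *)
- move=> V h [VY _]; split=> [|Vh]; first exact: kmorph_regular.
  have := kmorph_regular gm Vh; rewrite (kpreimK gX gK VY) => Vhg p i a Vp pa.
  have [P [Q [Qa PQ]]] := Vhg p i a Vp pa; exists P, Q; split=> // p' a' Vp' pa' Qa'.
  by rewrite -(PQ p' a') //= gK //; exact: VY.
Qed.

Lemma is_kiso_comp (X Y Z : kspace K) (f : kpt X -> kpt Y) (g : kpt Y -> kpt Z) :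
  is_kiso iota f -> is_kiso iota g -> is_kiso iota (g \o f).
Proof.
move=> [fb fo fr] [gb go gr].
have fX p : @kcar K X p -> @kcar K Y (f p) by case: fb => h _ _; exact: h.
have E V : kpreim (g \o f) V = kpreim f (kpreim g V) :> set (kpt X).
  apply/seteqP; split=> p; first by move=> [pX Vp]; do !split=> //; exact: fX.
  by move=> [pX [_ Vp]].
split; first exact: set_bij_comp fb gb.
- move=> V VZ; rewrite E go //; apply: fo; by move=> q [].
- by move=> V h Vo; rewrite E gr // fr //; apply/go => //; case: Vo.
Qed.

End KIsomorphisms.

(** * Cramer's rule with polynomial coefficients *)

Section Cramer.
Variables (k K : fieldType) (iota : {rmorphism k -> K}) (I : finType).
Local Notation poly := (mpoly #|I| k).

Definition kvar (i : I) : poly := @mpolyX _ k (mnm1 (enum_rank i)).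

Lemma peval_kvar a i : peval iota a (kvar i) = a i.
Proof. by rewrite /peval /kvar mmapX mmap1U enum_rankK. Qed.

(** The system may be overdetermined. Injectivity at a selects d rows independent there; their
    determinant Q stays nonzero in a neighbourhood, where these rows alone determine any solution.
    Solvability is not claimed. *)
Lemma local_cramer n d (A : 'M[poly]_(n, d)) (c : 'cV[poly]_n) (a : I -> K) :
    (forall y : 'cV_d, map_mx (peval iota a) A *m y = 0 -> y = 0) ->
  exists (Q : poly) (P : 'I_d -> poly), peval iota a Q != 0 /\
    forall a' (p : 'cV_d),
      map_mx (peval iota a') A *m p + map_mx (peval iota a') c = 0 ->
      peval iota a' Q != 0 ->
    forall l, p l 0 = peval iota a' (P l) / peval iota a' Q.
Proof.
move=> Ainj; pose A0 := map_mx (peval iota a) A.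
have fA : row_full A0.
  rewrite /row_full -mxrank_tr -/(row_free _).
  apply: inj_row_free => v vA; apply: trmx_inj; rewrite trmx0; apply: Ainj.
  by apply: trmx_inj; rewrite trmx_mul trmxK vA trmx0.
pose phi := fullrankfun fA; pose B := rowsub phi A.
exists (\det B), (fun l => - (\adj B *m rowsub phi c) l 0); split.
  rewrite -det_map_mx map_mxsub -unitfE -unitmxE; exact: fullrowsub_unit.
move=> a' p /(congr1 (rowsub phi)); rewrite raddfD /= -mul_rowsub_mx raddf0.
rewrite -!map_mxsub -/B => E Q0 l; apply: (mulIf Q0); rewrite divfK //.
have {E} : map_mx (peval iota a') B *m p = - map_mx (peval iota a') (rowsub phi c).
  by apply/eqP; rewrite -addr_eq0 E.
move/(congr1 (mulmx (\adj (map_mx (peval iota a') B)))).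
rewrite mulmxA mul_adj_mx mul_scalar_mx det_map_mx mulmxN -map_mx_adj -map_mxM.
move/matrixP/(_ l 0); rewrite !mxE mulrC => ->.
by rewrite rmorphN /=; congr (- _); rewrite !mxE.
Qed.

End Cramer.

(** * Charts of the Grassmannian *)

Section GrassmannianCharts.
Variable K : fieldType.
Local Notation L := (laurent K).
Implicit Types (M : set 'cV[L]_2) (N : nat).

Definition ksubspace M : Prop :=
  [/\ M 0, forall u v, M u -> M v -> M (u + v)
    & forall (c : K) u, M u -> M (mono c 0 *: u)].

Lemma ksubspaceB M u v : ksubspace M -> M u -> M v -> M (u - v).
Proof.
move=> [M0 MD MZ] Mu Mv; apply: MD => //.
have -> : - v = mono (-1) 0 *: v; last exact: MZ.
have -> : mono (-1) 0 = -1 :> L; last by rewrite scaleN1r.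
apply: (addIr 1); rewrite addNr -mono0 -mono_add addNr; exact: mono_zero.
Qed.

Lemma ksubspace_sum M (T : finType) (P : pred T) (F : T -> 'cV[L]_2) :
  ksubspace M -> (forall i, P i -> M (F i)) -> M (\sum_(i | P i) F i).
Proof. by move=> [M0 MD _] MF; elim/big_ind: _. Qed.

Definition kvec N (y : bidx N -> K) : 'cV[L]_2 := \sum_j bvec j (y j).

Lemma bvecD N (j : bidx N) (c c' : K) : bvec j (c + c') = bvec j c + bvec j c'.
Proof. by rewrite /bvec mono_add scalerDl. Qed.

Lemma bvecZ N (j : bidx N) (c c' : K) : bvec j (c * c') = mono c 0 *: bvec j c'.
Proof. by rewrite /bvec monocE scalerA. Qed.

Lemma bvec0 N (j : bidx N) : bvec j (0 : K) = 0.
Proof. by rewrite /bvec mono_zero scale0r. Qed.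

Lemma bvec_sum N (j : bidx N) (T : finType) (F : T -> K) :
  bvec j (\sum_i F i) = \sum_i bvec j (F i).
Proof. by apply: (big_morph (bvec j) (bvecD j)); exact: bvec0. Qed.

Lemma kvec_in N (S : {set bidx N}) (c : bidx N -> K) :
  \sum_(s in S) bvec s (c s) = kvec (fun s => if s \in S then c s else 0).
Proof.
by rewrite big_mkcond; apply: eq_bigr => s _; case: ifP; rewrite ?bvec0.
Qed.

(** The coordinates are the matrix of the projection along M. A vector minus its projection always
    lies in M, so membership in M means that the projection is in M, hence zero. This turns
    membership into linear equations with the coordinates as coefficients. *)
Lemma gr_coord_kvec N (S : {set bidx N}) M (a : bidx N -> bidx N -> K) y :
    ksubspace M -> gr_coord S M a ->
  M (kvec y) <-> forall s, \sum_j y j * a j s = 0.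
Proof.
move=> Mk [Ma MS aS]; have [M0 MD MZ] := Mk.
have D : M (kvec y - \sum_(s in S) bvec s (\sum_j y j * a j s)).
  have -> : kvec y - \sum_(s in S) bvec s (\sum_j y j * a j s) =
            \sum_j mono (y j) 0 *: (bvec j 1 - \sum_(s in S) bvec s (a j s)).
    rewrite (eq_bigr (fun s => \sum_j bvec s (y j * a j s))); last first.
      by move=> s _; rewrite bvec_sum.
    rewrite exchange_big /= /kvec -sumrB; apply: eq_bigr => j _.
    rewrite scalerBr -bvecZ mulr1 scaler_sumr; congr (_ - _).
    by apply: eq_bigr => s _; rewrite bvecZ.
  by apply: ksubspace_sum => // j _; exact: MZ.
split=> [My s|y0].
  have [sS|sS] := boolP (s \in S); last by rewrite big1 // => j _; rewrite aS ?mulr0.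
  apply: (MS (fun s => \sum_j y j * a j s)) => //.
  by rewrite -[X in M X](subKr (kvec y)); apply: ksubspaceB.
rewrite -[kvec y](subrK (\sum_(s in S) bvec s (\sum_j y j * a j s))).
by apply: MD => //; rewrite big1 // => s _; rewrite y0 bvec0.
Qed.

(** Projection along M is injective on the span of S', which meets M only in 0. Applied in both
    directions, it shows that all charts containing M have index sets of the same size. *)
Lemma gr_coord_card_le N (S S' : {set bidx N}) M (a : bidx N -> bidx N -> K) :
    ksubspace M -> gr_coord S M a ->
    (forall c : bidx N -> K, M (\sum_(s in S') bvec s (c s)) ->
       forall s, s \in S' -> c s = 0) ->
  (#|S'| <= #|S|)%N.
Proof.
move=> Mk Ma MS'.
pose A : 'M[K]_(#|S'|, #|S|) := \matrix_(i, j) a (enum_val i) (enum_val j).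
have /eqP <- : row_free A; last exact: rank_leq_col.
apply: inj_row_free => v vA.
pose y j := \sum_(i < #|S'| | enum_val i == j) v 0 i.
have yE i : y (enum_val i) = v 0 i.
  rewrite /y (bigD1 i) //= big1 ?addr0 // => i' /andP[/eqP/enum_val_inj-> ].
  by rewrite eqxx.
have yS j : j \notin S' -> y j = 0.
  move=> jS; rewrite /y big1 // => i /eqP ij; case/negP: jS; rewrite -ij.
  exact: enum_valP.
have ya s : \sum_j y j * a j s = 0.
  have [sS|sS] := boolP (s \in S); last first.
    by rewrite big1 // => j _; case: Ma => _ _ ->; rewrite ?mulr0.
  have <- : (v *m A) 0 (enum_rank_in sS s) = \sum_j y j * a j s.
    rewrite mxE (partition_big (fun i : 'I_(#|S'|) => enum_val i) xpredT) //=.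
    apply: eq_bigr => j _; rewrite /y mulr_suml; apply: eq_bigr => i /eqP ij.
    by rewrite mxE ij enum_rankK_in.
  by rewrite vA mxE.
have := (gr_coord_kvec y Mk Ma).2 ya.
have -> : kvec y = \sum_(s in S') bvec s (y s).
  by rewrite kvec_in; congr kvec; apply/funext => s; case: ifP => // /negbT/yS.
move=> /MS' y0; apply/rowP => i; rewrite mxE -yE; apply: y0; exact: enum_valP.
Qed.

Lemma kvec_entry N (y : bidx N -> K) (i : 'I_2) :
  kvec y i 0 = \sum_(r < N + N) mono (y (i, r)) (r%:Z - N%:Z).
Proof.
rewrite /kvec summxE (eq_bigr (fun j => \sum_r if j == (i, r) then
   mono (y (i, r)) (r%:Z - N%:Z) else 0)); last first.
  move=> [i' r'] _; rewrite /bvec !mxE /= eqxx andbT.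
  have [->|ii'] := eqVneq i i'.
    rewrite mulr1 (bigD1 r') //= eqxx big1 ?addr0 // => r rr'.
    by rewrite ifF //; apply/negbTE; rewrite xpair_eqE eqxx /= eq_sym.
  rewrite mulr0 big1 // => r _.
  by rewrite ifF //; apply/negbTE; rewrite xpair_eqE eq_sym (negbTE ii').
rewrite exchange_big /=; apply: eq_bigr => r _; rewrite -big_mkcond big_pred1_eq.
by [].
Qed.

Lemma lcoef_kvec N (y : bidx N -> K) (x : bidx N) :
  lcoef (kvec y x.1 0) (x.2%:Z - N%:Z) = y x.
Proof.
rewrite kvec_entry lcoef_sum (bigD1 x.2) //= /mono_fun eqxx big1 ?addr0.
  by case: x.
move=> r rx; rewrite ifF //; apply/negP => /eqP e; case/eqP: rx.
by apply: val_inj => /=; lia.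
Qed.

Lemma lcoef_kvec_out N (y : bidx N -> K) (i : 'I_2) (z : int) :
  (z < - N%:Z) || (N%:Z <= z) -> lcoef (kvec y i 0) z = 0.
Proof.
move=> zN; rewrite kvec_entry lcoef_sum big1 // => r _ /=; rewrite /mono_fun ifF //.
by apply/negP => /eqP; have := ltn_ord r; lia.
Qed.

Lemma bidx_coord N (i : 'I_2) (z : int) : - N%:Z <= z -> z < N%:Z ->
  exists2 x : bidx N, x.1 = i & x.2%:Z - N%:Z = z.
Proof.
move=> zN Nz; have r : (absz (z + N%:Z)%R < N + N)%N by lia.
by exists (i, Ordinal r) => //=; lia.
Qed.

End GrassmannianCharts.

(** * The lattices of a cell *)

Section CellLattices.
Variable K : fieldType.
Local Notation L := (laurent K).
Implicit Types (up : bool) (m n z : int) (N : nat).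

Definition idir up : 'I_2 := if up then 0 else 1.
Definition jdir up : 'I_2 := if up then 1 else 0.

(* The lattice with basis t^m (e_l + b e_u), t^n e_u, where b = lpoly (eps up) p
   and u = idir up, l = jdir up. *)
Definition cell_lattice up d (p : 'I_d -> K) m n : set 'cV[L]_2 :=
  [set u | val_ge m (u (jdir up) 0) /\
           val_ge n (u (idir up) 0 - lpoly (eps up) p * u (jdir up) 0)].

Lemma jdir_idir up : (jdir up == idir up) = false.
Proof. by case: up. Qed.

Lemma val_ge0_lpoly up d (p : 'I_d -> K) : val_ge 0 (lpoly (eps up) p).
Proof. by apply: (val_geW _ (@val_ge_lpoly _ _ _ _)); rewrite /eps; lia. Qed.

Lemma cell_lattice_ksubspace up d (p : 'I_d -> K) m n : ksubspace (cell_lattice up p m n).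
Proof.
split.
- by split; rewrite !mxE ?mulr0 ?subr0.
- move=> u v [um un] [vm vn]; split; rewrite !mxE; first exact: val_geD.
  rewrite mulrDr opprD addrACA; exact: val_geD.
- move=> c u [um un]; split; rewrite !mxE.
    by apply: (val_geM_le (@val_ge_mono _ c 0) um); lia.
  by rewrite mulrCA -mulrBr; apply: (val_geM_le (@val_ge_mono _ c 0) un); lia.
Qed.

Lemma monoM_lpoly m e d (p : 'I_d -> K) : t^m * lpoly e p = lpoly (m + e) p.
Proof.
rewrite mulr_sumr; apply: eq_bigr => l _; apply: laurent_eqP => z.
rewrite lcoef_monoM mul1r /= /mono_fun; congr (if _ then _ else _).
by apply/eqP/eqP; lia.
Qed.

Lemma lpoly0 e d : lpoly e (fun _ : 'I_d => 0 : K) = 0.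
Proof. by rewrite /lpoly big1 // => i _; exact: mono_zero. Qed.

Lemma bvecE N (j : bidx N) (c : K) (i : 'I_2) :
  bvec j c i 0 = if i == j.1 then mono c (j.2%:Z - N%:Z) else 0.
Proof. by rewrite /bvec !mxE eqxx andbT; case: eqP; rewrite ?mulr1 ?mulr0. Qed.

Lemma kvec_row0 N (y : bidx N -> K) (i : 'I_2) :
  (forall r, y (i, r) = 0) -> kvec y i 0 = 0.
Proof. by move=> y0; rewrite kvec_entry big1 // => r _; rewrite y0 mono_zero. Qed.

Section StandardChart.
Variables (up : bool) (d : nat) (p : 'I_d -> K) (N : nat) (m n : int).

Definition std_set : {set bidx N} :=
  [set x : bidx N | x.2%:Z - N%:Z < (if x.1 == idir up then n else m)]%SET.

(** For r >= m the vector t^r (e_l + b e_u) is in the lattice, so t^r e_l is congruent to - t^r b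
    e_u, of which the terms of exponent below n remain. Vectors t^r e_u with r >= n project to 0.
    The entries are thus constants or negated coefficients of b. *)
Definition std_coord (j s : bidx N) : K :=
  if j \in std_set then (s == j)%:R
  else if [&& s \in std_set, j.1 == jdir up & s.1 == idir up]
  then - lcoef (lpoly (eps up) p) (s.2%:Z - j.2%:Z) else 0.

Lemma gr_coord_std : n <= N%:Z -> gr_coord std_set (cell_lattice up p m n) std_coord.
Proof.
move=> nN; have iI := jdir_idir up; split.
- move=> j; rewrite kvec_in; set W := fun s => _.
  have [jS|jS] := boolP (j \in std_set).
    have -> : kvec W = bvec j 1.
      rewrite /kvec (bigD1 j) //= big1 ?addr0.
        by rewrite /W jS /std_coord jS eqxx.
      by move=> s sj; rewrite /W /std_coord jS (negbTE sj) if_same bvec0.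
    by rewrite subrr; case: (cell_lattice_ksubspace up p m n).
  have Wl : kvec W (jdir up) 0 = 0.
    apply: kvec_row0 => r; rewrite /W /std_coord (negbTE jS) /= iI !andbF.
    by rewrite if_same.
  move: jS; rewrite inE -leNgt => jS.
  have E i : (bvec j 1 - kvec W) i 0 = bvec j 1 i 0 - kvec W i 0.
    by rewrite mxE [X in _ + X]mxE.
  split; rewrite !E Wl subr0 !bvecE.
    case: eqP => [jl|_]; last exact: val_ge0.
    by apply: val_geW (@val_ge_mono _ _ _); move: jS; rewrite -jl iI.
  have jS' : j \notin std_set by rewrite inE -leNgt.
  have [jl|jl] := eqVneq j.1 (jdir up); last first.
    have ju : j.1 = idir up.
      by move: jl; case: (up); case: (j.1) => -[|[|//]] ?;
        rewrite -val_eqE //= => _; apply: val_inj.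
    rewrite ju eqxx in jS; rewrite ju eqxx mulr0 subr0.
    rewrite kvec_row0; last first.
      by move=> r; rewrite /W /std_coord (negbTE jS') (negbTE jl) /= andbF if_same.
    by rewrite subr0; apply: val_geW jS (@val_ge_mono _ _ _).
  rewrite jl eq_sym iI sub0r -opprD.
  apply: val_geN => z zn; rewrite lcoefD mulrC lcoef_monoM mul1r.
  have [zN|zN] := ltP z (- N%:Z).
    rewrite lcoef_kvec_out ?zN // add0r; apply: (@val_ge0_lpoly up d p).
    lia.
  (* The bound n <= N ensures that every exponent below n that can occur is an available basis
     index, so no term of t^r b below n is lost. *)
  have [x xu xz] := @bidx_coord N (idir up) z zN (lt_le_trans zn nN).
  rewrite -{1}xu -{1}xz lcoef_kvec.
  have xS : x \in std_set by rewrite inE xu eqxx xz.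
  rewrite /W xS /std_coord (negbTE jS') xS jl xu !eqxx /=.
  have -> : z - (j.2%:Z - N%:Z) = x.2%:Z - j.2%:Z by lia.
  by rewrite addNr.
- move=> c; rewrite kvec_in; set W := fun s => _ => -[Wl Wu] s sS.
  have Wl0 : kvec W (jdir up) 0 = 0.
    apply: kvec_row0 => r; rewrite /W; case: ifP => // rS.
    have := lcoef_kvec W (jdir up, r); rewrite /= /W rS => <-; apply: Wl.
    by move: rS; rewrite inE /= iI.
  have <- : W s = c s by rewrite /W sS.
  have [su|su] := eqVneq s.1 (idir up).
    rewrite -lcoef_kvec su; move: Wu; rewrite Wl0 mulr0 subr0; apply.
    by move: sS; rewrite inE su eqxx.
  rewrite -lcoef_kvec.
  have -> : s.1 = jdir up.
    by move: su; case: (up); case: (s.1) => -[|[|//]] ?;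
      rewrite -val_eqE //= => _; apply: val_inj.
  by rewrite Wl0.
- move=> j s sS; rewrite /std_coord (negbTE sS) /=; case: ifP => // jS.
  by case: eqP => // e; rewrite e jS in sS.
Qed.

Lemma card_ord_lt M q : (q <= M)%N -> #|[set r : 'I_M | (r < q)%N]%SET| = q.
Proof.
move=> qM; rewrite -sum1_card (eq_bigl (fun r : 'I_M => (r < q)%N)).
  by rewrite -(big_ord_widen M (fun=> 1%N) qM) sum1_card card_ord.
by move=> r; rewrite inE.
Qed.

Lemma card_std_set : - N%:Z <= m -> m <= N%:Z -> - N%:Z <= n -> n <= N%:Z ->
  #|std_set|%:Z = m + n + (N + N)%N%:Z.
Proof.
move=> Nm mN Nn nN.
have E : #|std_set| = (\sum_(i : 'I_2) absz ((if i == idir up then n else m) + N%:Z)%R)%N.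
  rewrite -sum1_card big_mkcond /=.
  rewrite (eq_bigr (fun x => if (x.1, x.2) \in std_set then 1 else 0)%N); last by case.
  rewrite -(pair_bigA _ (fun i r => if (i, r) \in std_set then 1 else 0)%N) /=.
  apply: eq_bigr => i _; rewrite -big_mkcond /=.
  set q := if _ then _ else _.
  have qM : (absz (q + N%:Z)%R <= N + N)%N by rewrite /q; case: ifP => _; lia.
  rewrite -[RHS](card_ord_lt qM) -sum1_card; apply: eq_bigl => r; rewrite !inE /= -/q.
  by rewrite /q; case: ifP => _; apply/idP/idP; lia.
rewrite E !big_ord_recl big_ord0 addn0; case: (up) => /=; lia.
Qed.

End StandardChart.

Lemma cell_lattice_chart_card up d (p : 'I_d -> K) m n N (S : {set bidx N}) a :
    gr_coord S (cell_lattice up p m n) a ->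
    - N%:Z <= m -> m <= N%:Z -> - N%:Z <= n -> n <= N%:Z ->
  #|S|%:Z = m + n + (N + N)%N%:Z.
Proof.
move=> Sa Nm mN Nn nN; rewrite -(@card_std_set up N m n) //.
have Mk := cell_lattice_ksubspace up p m n.
have st := @gr_coord_std up d p N m n nN.
congr Posz; apply/eqP; rewrite eqn_leq; apply/andP; split.
  by case: Sa => _ h _; exact: gr_coord_card_le Mk st h.
by case: st => _ h _; exact: gr_coord_card_le Mk Sa h.
Qed.

Section LinearSystem.
Variables (up : bool) (d : nat) (N : nat) (m n : int).
Hypotheses (Nm : - N%:Z <= m) (mN : m < N%:Z) (nN : n <= N%:Z).
Hypothesis nE : n = m + eps up + d%:Z.

(* The vectors t^m e_l and t^(m + eps + j) e_u in the basis of t^-N o^2 / t^N o^2. *)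
Definition at_const (x : bidx N) : bool :=
  (x.1 == jdir up) && (x.2%:Z - N%:Z == m).
Definition at_coef (x : bidx N) (j : 'I_d) : bool :=
  (x.1 == idir up) && (x.2%:Z - N%:Z == m + eps up + j%:Z).

(** Coordinates of c t^m e_l + t^m y(t) e_u, where y(t) is [lpoly (eps up) y]. For c = 1 and y = p
    this is a basis vector of the lattice and yields the inhomogeneous system for p; c = 0 yields
    the homogeneous one. *)
Let w (c : K) (y : 'I_d -> K) (x : bidx N) : K :=
  c * (at_const x)%:R + \sum_j y j * (at_coef x j)%:R.

Let w_low c y : kvec (w c y) (jdir up) 0 = mono c m.
Proof.
apply: laurent_eqP => z; have [zN|zN] := boolP ((z < - N%:Z) || (N%:Z <= z)).
  rewrite lcoef_kvec_out //= /mono_fun ifF //; apply/negbTE; lia.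
have [||x xl xz] := @bidx_coord N (jdir up) z; try lia.
rewrite -{1}xl -{1}xz lcoef_kvec /w /at_const xl eqxx xz big1 ?addr0.
  by rewrite /= /mono_fun; case: eqP; rewrite ?mulr1 ?mulr0.
by move=> j _; rewrite /at_coef xl jdir_idir mulr0.
Qed.

Let w_dir c y : kvec (w c y) (idir up) 0 = lpoly (m + eps up) y.
Proof.
apply: laurent_eqP => z; rewrite lcoef_sum.
have e0 : 0 <= eps up by rewrite /eps; lia.
have [zN|zN] := boolP ((z < - N%:Z) || (N%:Z <= z)).
  rewrite lcoef_kvec_out // big1 // => j _ /=; rewrite /mono_fun ifF //.
  by apply/negbTE; have := ltn_ord j; lia.
have [||x xu xz] := @bidx_coord N (idir up) z; try lia.
rewrite -{1}xu -{1}xz lcoef_kvec /w /at_const xu eq_sym jdir_idir mulr0 add0r.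
apply: eq_bigr => j _; rewrite /at_coef xu eqxx xz /= /mono_fun.
by case: eqP; rewrite ?mulr1 ?mulr0.
Qed.

Let w_sum c y (a : bidx N -> bidx N -> K) s : \sum_x w c y x * a x s =
  c * (\sum_x (at_const x)%:R * a x s) + \sum_j y j * (\sum_x (at_coef x j)%:R * a x s) :> K.
Proof.
rewrite mulr_sumr (eq_bigr (fun j => \sum_x y j * ((at_coef x j)%:R * a x s))); last first.
  by move=> j _; rewrite mulr_sumr.
rewrite exchange_big -big_split /=; apply: eq_bigr => x _.
rewrite mulrDl mulrA mulr_suml; congr (_ + _); apply: eq_bigr => j _.
by rewrite mulrA.
Qed.

Variables (p : 'I_d -> K) (S : {set bidx N}) (a : bidx N -> bidx N -> K).
Hypothesis Sa : gr_coord S (cell_lattice up p m n) a.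

Lemma cell_lattice_system s :
  \sum_x (at_const x)%:R * a x s + \sum_j p j * (\sum_x (at_coef x j)%:R * a x s) = 0.
Proof.
have : cell_lattice up p m n (kvec (w 1 p)).
  split; rewrite w_low; first exact: val_ge_mono.
  by rewrite w_dir mulrC monoM_lpoly subrr.
move/(gr_coord_kvec _ (cell_lattice_ksubspace up p m n) Sa)/(_ s).
by rewrite w_sum mul1r.
Qed.

(** A homogeneous solution is a vector t^m y(t) e_u in the lattice, so its coefficients below t^n
    vanish. By [nE] these are all d coefficients of y. *)
Lemma cell_lattice_system_inj (y : 'I_d -> K) :
  (forall s, \sum_j y j * (\sum_x (at_coef x j)%:R * a x s) = 0) -> y = fun=> 0.
Proof.
move=> y0; have : cell_lattice up p m n (kvec (w 0 y)).
  apply/(gr_coord_kvec _ (cell_lattice_ksubspace up p m n) Sa) => s.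
  by rewrite w_sum mul0r add0r.
move=> [_]; rewrite w_low w_dir mono_zero mulr0 nE => h.
by apply: (@lpoly_inj K (m + eps up)); rewrite lpoly0.
Qed.

End LinearSystem.

Lemma cell_lattice_inj up d (p q : 'I_d -> K) m n : n = m + eps up + d%:Z ->
  cell_lattice up p m n `<=` cell_lattice up q m n -> p = q.
Proof.
move=> nE pq; pose b := lpoly (eps up) p.
pose u : 'cV[L]_2 := \col_i (if i == jdir up then t^m else t^m * b).
have [ul ui] : u (jdir up) 0 = t^m /\ u (idir up) 0 = t^m * b.
  by rewrite !mxE eqxx eq_sym jdir_idir.
have : cell_lattice up p m n u.
  split; first by rewrite ul; exact: val_ge_mono.
  by rewrite ul ui [_ * t^m]mulrC subrr.
move=> /pq[_]; rewrite ul ui [lpoly _ q * _]mulrC !monoM_lpoly nE; exact: lpoly_inj.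
Qed.

End CellLattices.

(** * Families of cells in the affine flag manifold *)

Section FlagCells.
Variables (k K : fieldType) (iota : {rmorphism k -> K}).
Local Notation L := (laurent K).
Implicit Types (up : bool) (m n : int) (N : nat).

Lemma base1_dir up (u : 'cV[L]_2) :
  base1 u <-> val_ge 0 (u (idir up) 0) /\ val_ge 0 (u (jdir up) 0).
Proof. by case: up; split=> -[]. Qed.

Lemma scale_entry (c : L) (u : 'cV[L]_2) i : (c *: u) i 0 = c * u i 0.
Proof. by rewrite mxE. Qed.

(** The smaller lattice contains t^N e_l and t^N e_u, which bounds [m0] and [n0] above; the larger
    one contributes its own basis vectors, which bounds [m1] and [n1] below. *)
Lemma bounded_chain_range up d (p : 'I_d -> K) m0 n0 m1 n1 N (c : set 'M[L]_2) :
    lat (@base0 K) c = cell_lattice up p m0 n0 -> lat (@base1 K) c = cell_lattice up p m1 n1 ->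
    bounded_chain N c ->
  [/\ m0 <= N%:Z, n0 <= N%:Z, - N%:Z <= m1 & - N%:Z <= n1].
Proof.
move=> c0 c1 [b0 b1]; rewrite c0 in b0; rewrite c1 in b1.
have iI := jdir_idir up; have Ii : (idir up == jdir up) = false by rewrite eq_sym.
have v1 : val_ge 0 (1 : L) by exact: is_order_ge (is_order1 K).
have e (i : 'I_2) : base1 (delta_mx i 0 : 'cV[L]_2).
  by split; rewrite !mxE; case: eqP.
split.
- have [+ _] := b0 _ (e (jdir up)); rewrite scale_entry mxE !eqxx mulr1.
  exact: is_order_le (is_order_mono K _).
- have [_ +] := b0 _ (e (idir up)); rewrite !scale_entry !mxE !eqxx iI /= mulr1 !mulr0 subr0.
  exact: is_order_le (is_order_mono K _).
- pose u : 'cV[L]_2 := \col_i (if i == jdir up then t^m1 else t^m1 * lpoly (eps up) p).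
  have pu : cell_lattice up p m1 n1 u.
    split; rewrite !mxE !eqxx; first exact: val_ge_mono.
    by rewrite Ii [_ * t^m1]mulrC subrr.
  have /(base1_dir up)[_] := b1 _ pu; rewrite scale_entry mxE eqxx -monoD.
  by move/(is_order_le (is_order_mono K _)); lia.
- pose u : 'cV[L]_2 := \col_i (if i == jdir up then 0 else t^n1).
  have pu : cell_lattice up p m1 n1 u.
    split; rewrite !mxE !eqxx; first exact: val_ge0.
    by rewrite Ii mulr0 subr0; exact: val_ge_mono.
  have /(base1_dir up)[+ _] := b1 _ pu; rewrite scale_entry mxE Ii -monoD.
  by move/(is_order_le (is_order_mono K _)); lia.
Qed.

Lemma bounded_chain_cell_lattice up d (p : 'I_d -> K) m0 n0 m1 n1 N (c : set 'M[L]_2) :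
    lat (@base0 K) c = cell_lattice up p m0 n0 -> lat (@base1 K) c = cell_lattice up p m1 n1 ->
    m0 <= N%:Z -> n0 <= N%:Z -> - N%:Z <= m1 -> - N%:Z <= n1 ->
  bounded_chain N c.
Proof.
move=> c0 c1 Nm0 Nn0 Nm1 Nn1; rewrite /bounded_chain c0 c1.
have b0 := @val_ge0_lpoly K up d p; have vN := @val_ge_mono K 1 N.
split=> u; first move=> /(base1_dir up)[ui ul].
  split; rewrite !scale_entry.
    by apply: (val_geM_le vN ul); lia.
  rewrite mulrCA -mulrBr; apply: (val_geM_le vN (n := 0)); last by lia.
  apply: val_geB => //; exact: val_geM b0 ul.
move=> [ul ui]; apply/(base1_dir up); rewrite !scale_entry; split; last first.
  by apply: (val_geM_le vN ul); lia.
rewrite -[u (idir up) 0](subrK (lpoly (eps up) p * u (jdir up) 0)) mulrDr.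
apply: val_geD; first by apply: (val_geM_le vN ui); lia.
by apply: (val_geM_le vN (val_geM b0 ul)); lia.
Qed.

Lemma lpoly_coef_poly d (e z : int) : exists P : mpoly #|'I_d| k,
  forall p : 'I_d -> K, peval iota p P = lcoef (lpoly e p) z.
Proof.
exists (\sum_(j < d) (if z == e + j%:Z then kvar k j else 0)) => p.
rewrite rmorph_sum lcoef_sum; apply: eq_bigr => j _ /=; rewrite /mono_fun.
by case: ifP => _; rewrite ?peval_kvar ?rmorph0.
Qed.

Lemma std_coord_poly up d N m n (j s : bidx N) : exists P : mpoly #|'I_d| k,
  forall p : 'I_d -> K, peval iota p P = std_coord up p m n j s.
Proof.
rewrite /std_coord; case: (j \in _).
  by exists (s == j)%:R => p; exact: rmorph_nat.
case: [&& _, _ & _]; last by exists 0 => p; rewrite rmorph0.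
have [P PE] := lpoly_coef_poly d (eps up) (s.2%:Z - j.2%:Z).
by exists (- P) => p; rewrite rmorphN /= PE.
Qed.

Variables (T : Type) (J : set T) (d : nat).
Variables (f : T * ('I_d -> K) -> set 'M[L]_2) (Z : set (set 'M[L]_2)).
Variables (up : T -> bool) (m0 n0 m1 n1 : T -> int).
Hypothesis fZ : forall j p, J j -> Z (f (j, p)).
Hypothesis Zf : forall c, Z c -> exists j p, J j /\ c = f (j, p).
Hypothesis lat0 : forall j p, J j ->
  lat (@base0 K) (f (j, p)) = cell_lattice (up j) p (m0 j) (n0 j).
Hypothesis lat1 : forall j p, J j ->
  lat (@base1 K) (f (j, p)) = cell_lattice (up j) p (m1 j) (n1 j).
Hypothesis lat01 : forall j, J j -> m1 j <= m0 j /\ n1 j <= n0 j.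
(** At least one lattice of the chain must have n - m large enough to detect all d coefficients of
    b; the equations for the coordinates are taken from that lattice. *)
Hypothesis full : forall j, J j ->
  n0 j = m0 j + eps (up j) + d%:Z \/ n1 j = m1 j + eps (up j) + d%:Z.
Hypothesis key : forall j j', J j -> J j' -> m0 j + n0 j = m0 j' + n0 j' -> j = j'.

Let X := kcoprod J (affine_space K d).
Let Y := flag_space Z.

Lemma flag_cells_range j p N : J j -> bounded_chain N (f (j, p)) ->
  [/\ m0 j <= N%:Z, n0 j <= N%:Z, - N%:Z <= m1 j & - N%:Z <= n1 j].
Proof. by move=> Jj; apply: bounded_chain_range (lat0 p Jj) (lat1 p Jj). Qed.

(** N and the standard index sets depend only on j, so a single chart contains the image of a whole
    component. The coordinates there are polynomial in p, and the denominator is 1. *)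
Lemma flag_cells_morph : @kmorph k K iota X Y f.
Proof.
move=> [j p] [/= Jj _]; split; first exact: fZ.
move=> [j' []] a /= [jj' ap]; subst j' a.
have [m10 n10] := lat01 Jj.
pose N := (absz (m0 j) + absz (n0 j) + absz (m1 j) + absz (n1 j))%N.
have N0 : n0 j <= N%:Z by rewrite /N; lia.
have N1 : n1 j <= N%:Z by rewrite /N; lia.
pose S0 := @std_set (up j) N (m0 j) (n0 j); pose S1 := @std_set (up j) N (m1 j) (n1 j).
have /choice[P PE] : forall v : bool * bidx N * bidx N, exists P : mpoly #|'I_d| k,
    forall p, peval iota p P = (if v.1.1 then std_coord (up j) p (m1 j) (n1 j) v.1.2 v.2
      else std_coord (up j) p (m0 j) (n0 j) v.1.2 v.2).
  by move=> [[b x] s] /=; case: b; exact: std_coord_poly.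
exists (existT _ N (S0, S1)), 1, P; split; first by rewrite rmorph1 oner_neq0.
move=> [j'' p'] a' _ /= [-> ->] _; rewrite rmorph1; split=> /=.
- by apply: (bounded_chain_cell_lattice (lat0 p' Jj) (lat1 p' Jj)); rewrite /N; lia.
- have -> : (fun x s => peval iota p' (P (false, x, s)) / 1) = std_coord (up j) p' (m0 j) (n0 j).
    by apply/funext => x; apply/funext => s; rewrite divr1 PE.
  by rewrite lat0 //; exact: gr_coord_std.
- have -> : (fun x s => peval iota p' (P (true, x, s)) / 1) = std_coord (up j) p' (m1 j) (n1 j).
    by apply/funext => x; apply/funext => s; rewrite divr1 PE.
  by rewrite lat1 //; exact: gr_coord_std.
Qed.

(* The size of S0 is the codimension of the lattice, which determines m0 + n0. *)
Lemma flag_cells_component j p j' p' (i : flag_chart) a a' : J j -> J j' ->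
  @kcoord K Y i (f (j, p)) a -> @kcoord K Y i (f (j', p')) a' -> j = j'.
Proof.
case: i a a' => N [S0 S1] a a' Jj Jj' [/= b c0 _] [/= b' c0' _].
have [? ? ? ?] := flag_cells_range Jj b; have [? ? ? ?] := flag_cells_range Jj' b'.
have [? ?] := lat01 Jj; have [? ?] := lat01 Jj'.
rewrite lat0 // in c0; rewrite lat0 // in c0'.
have e : #|S0|%:Z = m0 j + n0 j + (N + N)%N%:Z by apply: (cell_lattice_chart_card c0); lia.
have e' : #|S0|%:Z = m0 j' + n0 j' + (N + N)%N%:Z by apply: (cell_lattice_chart_card c0'); lia.
by apply: key => //; lia.
Qed.

Lemma flag_cells_inj j p j' p' : J j -> J j' -> f (j, p) = f (j', p') -> (j, p) = (j', p').
Proof.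
move=> Jj Jj' e; have [_ h] := flag_cells_morph (conj Jj I : @kcar K X (j, p)).
have [i [Q [P [Q0 QP]]]] := h (j, tt) p (conj erefl erefl).
have c := QP (j, p) p (conj Jj I) (conj erefl erefl) Q0.
have jj' : j = j' by move: (c); rewrite e => c'; exact: flag_cells_component Jj Jj' c c'.
subst j'; congr (_, _).
have [n0E|n1E] := full Jj.
  by apply: (cell_lattice_inj n0E); rewrite -!lat0 // e.
by apply: (cell_lattice_inj n1E); rewrite -!lat1 // e.
Qed.

(** The chart is arbitrary here, as the inverse map must be rational in all of them. The Boolean t
    below selects the lattice provided by [full], and the polynomials found at one point serve for
    every nearby point of the component. *)
Lemma cell_lattice_solve j p N (S0 S1 : {set bidx N}) a : J j ->
    @kcoord K Y (existT _ N (S0, S1)) (f (j, p)) a ->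
  exists (Q : mpoly #|{: bool * bidx N * bidx N}| k) (P : 'I_d -> mpoly _ k),
    peval iota a Q != 0 /\
    forall p' a', @kcoord K Y (existT _ N (S0, S1)) (f (j, p')) a' ->
      peval iota a' Q != 0 -> p' = fun l => peval iota a' (P l) / peval iota a' Q.
Proof.
move=> Jj ca; have [m10 n10] := lat01 Jj.
(* For d = 0 the bound m < N of the linear system can fail, for instance with m = n = N, but there
   is nothing to solve. *)
have [d0|d0] := posnP d.
  exists 1, (fun=> 0); rewrite rmorph1 oner_neq0; split=> // p' a' _ _.
  by apply/funext => -[l ld]; exfalso; rewrite d0 in ld.
have [b c0 c1] := ca; rewrite /= in b c0 c1.
have [? ? ? ?] := flag_cells_range Jj b.
suff [t [m [n [Nm mN nN nE clat]]]] : exists (t : bool) (m n : int),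
    [/\ - N%:Z <= m, m < N%:Z, n <= N%:Z, n = m + eps (up j) + d%:Z
      & forall p' a', @kcoord K Y (existT _ N (S0, S1)) (f (j, p')) a' ->
          gr_coord (if t then S1 else S0) (cell_lattice (up j) p' m n) (fun x s => a' (t, x, s))].
  pose A : 'M[mpoly #|{: bool * bidx N * bidx N}| k]_(#|{: bidx N}|, d) :=
    \matrix_(s, l) \sum_x (at_coef (up j) m x l)%:R * kvar k (t, x, enum_val s).
  pose c : 'cV[mpoly #|{: bool * bidx N * bidx N}| k]_#|{: bidx N}| :=
    \col_s \sum_x (at_const (up j) m x)%:R * kvar k (t, x, enum_val s).
  have AE a' s l : map_mx (peval iota a') A s l =
      \sum_x (at_coef (up j) m x l)%:R * a' (t, x, enum_val s).
    rewrite !mxE rmorph_sum; apply: eq_bigr => x _.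
    by rewrite rmorphM rmorph_nat /= peval_kvar.
  have cE a' s : map_mx (peval iota a') c s 0 =
      \sum_x (at_const (up j) m x)%:R * a' (t, x, enum_val s).
    rewrite !mxE rmorph_sum; apply: eq_bigr => x _.
    by rewrite rmorphM rmorph_nat /= peval_kvar.
  have [|Q [P [Qa QP]]] := @local_cramer k K iota _ _ _ A c a.
    move=> y yA; have := cell_lattice_system_inj Nm mN nN nE (clat p a ca) (y := fun l => y l 0).
    move=> h; apply/colP => l; rewrite [RHS]mxE -[RHS]/((fun=> 0 : K) l) -h // => s.
    have /matrixP/(_ (enum_rank s) 0) := yA; rewrite mxE [RHS]mxE; apply: etrans.
    by apply: eq_bigr => l' _; rewrite AE enum_rankK mulrC.
  exists Q, P; split=> // p' a' ca' Qa'; apply/funext => l.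
  rewrite -(QP a' (\col_l p' l)) ?mxE //; apply/colP => s.
  have E := cell_lattice_system Nm mN nN nE (clat p' a' ca') (enum_val s).
  rewrite [RHS]mxE; apply: etrans E; rewrite mxE cE addrC; congr (_ + _).
  by rewrite mxE; apply: eq_bigr => l' _; rewrite AE mxE mulrC.
have [n0E|n1E] := full Jj.
  exists false, (m0 j), (n0 j); split=> //; try by rewrite /eps in n0E; lia.
  by move=> p' a' [_ + _]; rewrite lat0.
exists true, (m1 j), (n1 j); split=> //; try by rewrite /eps in n1E; lia.
by move=> p' a' [_ _]; rewrite lat1.
Qed.

(** Points sharing a chart lie in the same component, so the chart of the coproduct indexed by (j,
    tt) can be used throughout and only p has to be solved for. *)
Lemma flag_cells_inv_morph (g : set 'M[L]_2 -> T * ('I_d -> K)) :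
  (forall j p, J j -> g (f (j, p)) = (j, p)) -> @kmorph k K iota Y X g.
Proof.
move=> gK c Zc; have [j [p [Jj ->]]] := Zf Zc; rewrite gK //.
split=> // -[N [S0 S1]] a ca; have [Q [P [Qa QP]]] := cell_lattice_solve Jj ca.
exists (j, tt), Q, P; split=> // c' a' Zc' ca' Qa'.
have [j' [p' [Jj' c'E]]] := Zf Zc'; rewrite c'E in ca' *; rewrite gK //.
have jj' := flag_cells_component Jj Jj' ca ca'; subst j'.
by split=> //=; rewrite [RHS](QP p' a').
Qed.

(** [t0] only supplies values of g outside Z. Both directions are recorded because the SL_2
    statement starts from the flag space and the GL_2 statement from the coproduct. *)
Lemma flag_cells_kiso (t0 : T) :
  @is_kiso k K iota X Y f /\ exists g, @is_kiso k K iota Y X g.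
Proof.
have /choice[g gP] : forall c, exists q : T * ('I_d -> K),
    Z c -> J q.1 /\ f q = c.
  move=> c; have [Zc|nZc] := pselect (Z c); last by exists (t0, fun=> 0) => /nZc.
  by have [j [p [Jj ->]]] := Zf Zc; exists (j, p).
have gK j p : J j -> g (f (j, p)) = (j, p).
  move=> Jj; have [] := gP _ (fZ p Jj).
  by case: (g _) => j' p' /= Jj' e; apply: flag_cells_inj.
have gm := flag_cells_inv_morph gK.
have fK c : @kcar K Y c -> f (g c) = c by move=> /gP[].
have gfK q : @kcar K X q -> g (f q) = q by case: q => j p [/gK].
split; first exact: kmorph_kiso flag_cells_morph gm gfK fK.
by exists g; exact: kmorph_kiso gm flag_cells_morph fK gfK.
Qed.

End FlagCells.

(** * Lattice chains of the cells and their translates by powers of b1 *)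

Section LatticesOfCells.
Variable K : fieldType.
Local Notation L := (laurent K).
Implicit Types (x i : 'M[L]_2) (o up : bool) (h m n z : int).

Lemma iwahori_base i (u : 'cV[L]_2) : iwahori i ->
  (base0 u -> base0 (i *m u)) /\ (base1 u -> base1 (i *m u)).
Proof.
rewrite [i]mx2E => /iwahori_mx2[a b c d]; split=> -[u0 u1]; split;
  rewrite mulmx2_entry !mxE /=; apply: val_geD.
- by apply: (val_geM_le (is_order_ge a) u0).
- by apply: (val_geM_le b u1).
- by apply: (val_geM_le c u0).
- by apply: (val_geM_le (is_order_ge d) u1).
- by apply: (val_geM_le (is_order_ge a) u0).
- by apply: (val_geM_le b u1).
- by apply: (val_geM_le c u0).
- by apply: (val_geM_le (is_order_ge d) u1).
Qed.

Lemma lat_lcoset x (A : set 'M[L]_2) (B : set 'cV[L]_2) :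
    x \in unitmx -> A 1%:M -> (forall a u, A a -> B u -> B (a *m u)) ->
  lat B (lcoset x A) = [set v | B (invmx x *m v)].
Proof.
move=> xu A1 AB; apply/seteqP; split=> v /=.
  by move=> [_ [a Aa <-] [u Bu <-]]; rewrite -mulmxA mulKmx //; exact: AB.
move=> Bv; exists x; first by exists 1%:M => //; rewrite mulmx1.
by exists (invmx x *m v) => //; rewrite mulKVmx.
Qed.

Lemma preim_invmx x (B P : set 'cV[L]_2) : x \in unitmx ->
  (forall u, B u <-> P (x *m u)) -> [set v | B (invmx x *m v)] = P.
Proof.
move=> xu BP; apply/seteqP; split=> v /=; first by move/BP; rewrite mulKVmx.
by move=> Pv; apply/BP; rewrite mulKVmx.
Qed.

(** The exponent of t in row [jdir] of the monomial matrix [cellv]; the other row has the opposite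
    exponent. *)
Definition cell_exp o h : int :=
  if uptype o h == o then h + (o : nat)%:Z else - (h + (o : nat)%:Z).
(** The smaller base lattice multiplies the second basis vector by t. The shift is 1 for c = true
    when [cellv] sends that vector along e_u, and for c = false when it sends it along e_l. *)
Definition cell_shift (c : bool) o h : int := (((uptype o h == o) == c) : nat)%:Z.

Lemma val_ge_pair m n m' n' y z (f g a c : L) :
    is_order f m -> is_order g n -> m' = m + y -> n' = n + z ->
  (val_ge y a /\ val_ge z c) <-> (val_ge m' (f * a) /\ val_ge n' (g * c)).
Proof.
move=> fm gn -> ->; split=> -[h1 h2]; split.
- exact/(val_geMl _ _ fm).
- exact/(val_geMl _ _ gn).
- by move/(val_geMl _ _ fm): h1.
- by move/(val_geMl _ _ gn): h2.
Qed.

Lemma cell_base o h d (p : 'I_d -> K) (u : 'cV[L]_2) :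
  (base1 u <-> cell_lattice (uptype o h) p (cell_exp o h) (- cell_exp o h) (cell o h p *m u)) /\
  (base0 u <-> cell_lattice (uptype o h) p (cell_exp o h + cell_shift false o h)
                (- cell_exp o h + cell_shift true o h) (cell o h p *m u)).
Proof.
rewrite /cell /cell_exp /cell_shift /cell_lattice /cellv /uni /wdiag /wanti /eps /base0 /base1 /=.
case: o; rewrite /uptype; [case: (ltP h 0) | case: (leP 0 h)] => hs /=;
  rewrite !mx2M !mulmx2_entry !mxE /= !(mul0r, mulr0, mul1r, mulr1, add0r, addr0);
  move: (u 0 0) (u 1 0) (lpoly _ p) => a c b.
- have -> : b * - t^(h + 1) * a + t^(- (h + 1)) * c - b * (- t^(h + 1) * a)
     = t^(- (h + 1)) * c by ring.
  have om := is_orderN (is_order_mono K (h + 1)).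
  have on := is_order_mono K (- (h + 1)).
  by split; [apply: (val_ge_pair (y := 0) (z := 0) _ _ om on)
    | apply: (val_ge_pair (y := 0) (z := 1) _ _ om on)]; lia.
- have -> : - t^(h + 1) * a + b * t^(- (h + 1)) * c - b * (t^(- (h + 1)) * c)
     = - t^(h + 1) * a by ring.
  have om := is_orderN (is_order_mono K (h + 1)).
  have on := is_order_mono K (- (h + 1)).
  by split; apply: (iff_trans (and_comm _ _));
    [apply: (val_ge_pair (y := 0) (z := 0) _ _ on om)
    | apply: (val_ge_pair (y := 1) (z := 0) _ _ on om)]; lia.
- have -> : t^(- - h) * a + b * t^(- h) * c - b * (t^(- h) * c) = t^(- - h) * a by ring.
  have om := is_order_mono K (- h); have on := is_order_mono K (- - h).
  by split; apply: (iff_trans (and_comm _ _));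
    [apply: (val_ge_pair (y := 0) (z := 0) _ _ om on)
    | apply: (val_ge_pair (y := 1) (z := 0) _ _ om on)]; lia.
- have -> : b * t^(- - h) * a + t^(- h) * c - b * (t^(- - h) * a) = t^(- h) * c by ring.
  have om := is_order_mono K (- h); have on := is_order_mono K (- - h).
  by split; [apply: (val_ge_pair (y := 0) (z := 0) _ _ on om)
    | apply: (val_ge_pair (y := 0) (z := 1) _ _ on om)]; lia.
Qed.

Lemma lat_cell o h d (p : 'I_d -> K) (A : set 'M[L]_2) :
    A `<=` @iwahori K -> A 1%:M ->
  lat (@base1 K) (lcoset (cell o h p) A) =
    cell_lattice (uptype o h) p (cell_exp o h) (- cell_exp o h) /\
  lat (@base0 K) (lcoset (cell o h p) A) =
    cell_lattice (uptype o h) p (cell_exp o h + cell_shift false o h)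
      (- cell_exp o h + cell_shift true o h).
Proof.
move=> AI A1; have xu := @cell_unit K o h d p.
split; (rewrite lat_lcoset //; last by move=> a u /AI Ia; have [] := iwahori_base u Ia).
  by apply: preim_invmx => // u; have [] := cell_base o h p u.
by apply: preim_invmx => // u; have [] := cell_base o h p u.
Qed.

Lemma cell_shift_eq o h :
  [/\ cell_shift false o h + cell_shift true o h = 1,
      0 <= cell_shift false o h & 0 <= cell_shift true o h].
Proof. by rewrite /cell_shift; case: (_ == o). Qed.

(** n - m is even for the larger lattice and odd for the smaller one, so the parity of eps + d
    decides which of them sees all coefficients. *)
Lemma cell_full o h :
  - cell_exp o h + cell_shift true o h =
    cell_exp o h + cell_shift false o h + eps (uptype o h) + (absz (parity o h))%:Z \/
  - cell_exp o h = cell_exp o h + eps (uptype o h) + (absz (parity o h))%:Z.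
Proof.
rewrite /cell_exp /cell_shift /eps /parity.
case: o; rewrite /uptype; [case: (ltP h 0) | case: (leP 0 h)] => hs /=; lia.
Qed.

(** Since b1^2 = t, this is the power of b1 with exponent [parity o z]. These elements of J realize
    every valuation of the determinant. *)
Definition gshift o z : 'M[L]_2 := (t^z)%:M *m (if o then b1 K else 1%:M).

Lemma det_gshift o z : is_order (\det (gshift o z)) (parity o z).
Proof.
rewrite det_mulmx det_scalar expr2 -monoD /parity.
case: o; rewrite ?det_b1 ?det1.
  exact: is_orderM (is_order_mono K _) (is_orderN (is_order_mono K 1)).
exact: is_orderM (is_order_mono K _) (is_order1 K).
Qed.

Lemma gshift_unit o z : gshift o z \in unitmx.
Proof. by apply/gl2E/(is_order_neq0 (det_gshift o z)). Qed.

(** b1 exchanges the directions e_u and e_l and multiplies one of them by t. That factor turns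
    [lpoly 0 p] into [lpoly 1 p] or back, so the type flips while the coordinates p are
    unchanged. *)
Lemma gshift_cell_lattice o z up d (p : 'I_d -> K) m n u :
  cell_lattice up p m n u <->
  cell_lattice (o (+) up) p (m + z + (if o then eps up else 0))
    (n + z + (if o then 1 - eps up else 0)) (gshift o z *m u).
Proof.
have E (r : 'I_2) : (gshift o z *m u) r 0 = t^z * ((if o then b1 K else 1%:M) *m u) r 0.
  by rewrite -mulmxA mul_scalar_mx mxE.
rewrite /cell_lattice /= !E; case: o {E}; rewrite /= ?addr0 ?mul1mx; last first.
  rewrite mulrCA -mulrBr.
  by apply: (val_ge_pair _ _ (is_order_mono K z) (is_order_mono K z)); lia.
have l1 : lpoly 1 p = t^1 * lpoly 0 p by rewrite monoM_lpoly addr0.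
rewrite !mulmx2_entry !mxE /=; case: up; rewrite /eps /= !(mul0r, mul1r, add0r, addr0, subr0).
- have -> : t^z * (t^1 * u 0 0) - lpoly 1 p * (t^z * u 1 0) =
            t^(z + 1) * (u 0 0 - lpoly 0 p * u 1 0).
    by rewrite l1 monoD; ring.
  by apply: (val_ge_pair _ _ (is_order_mono K z) (is_order_mono K (z + 1))); lia.
- have -> : t^z * u 1 0 - lpoly 0 p * (t^z * (t^1 * u 0 0)) =
            t^z * (u 1 0 - lpoly 1 p * u 0 0).
    by rewrite l1; ring.
  rewrite [t^z * (t^1 * _)]mulrA -monoD.
  by apply: (val_ge_pair _ _ (is_order_mono K (z + 1)) (is_order_mono K z)); lia.
Qed.

Lemma lat_gshift o z x (A : set 'M[L]_2) (B : set 'cV[L]_2) up d (p : 'I_d -> K) m n :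
    x \in unitmx -> lat B (lcoset x A) = cell_lattice up p m n ->
  lat B (lcoset (gshift o z *m x) A) =
    cell_lattice (o (+) up) p (m + z + (if o then eps up else 0))
    (n + z + (if o then 1 - eps up else 0)).
Proof.
move=> xu E; have gu := gshift_unit o z.
have -> : lat B (lcoset (gshift o z *m x) A) = [set gshift o z *m v | v in lat B (lcoset x A)].
  apply/seteqP; split=> [_ [_ [a Aa <-] [u Bu <-]]|_ [_ [_ [a Aa <-] [u Bu <-]] <-]].
    by exists (x *m a *m u); rewrite ?mulmxA //; exists (x *m a); [exists a | exists u].
  by exists (gshift o z *m x *m a); [exists a | exists u]; rewrite ?mulmxA.
rewrite E; apply/seteqP; split=> [_ [v + <-]|v]; first by move/(gshift_cell_lattice o z).
move=> vP; exists (invmx (gshift o z) *m v); last by rewrite mulKVmx.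
by apply/(gshift_cell_lattice o z); rewrite mulKVmx.
Qed.

End LatticesOfCells.

(** * The affine Deligne-Lusztig varieties *)

Section Assembly.
Variables (k : finFieldType) (K : fieldType) (iota : {rmorphism k -> K}).
Local Notation L := (laurent K).
Local Notation sigma := (map_mx (frob k (K := K))).
Implicit Types (g i x y : 'M[L]_2) (o : bool) (h z : int).

Lemma parity_inj o h o' h' : parity o h = parity o' h' -> o = o' /\ h = h'.
Proof. by rewrite /parity; case: o; case: o' => /=; split=> //; lia. Qed.

Lemma parity_surj z : exists q : bool * int, z = parity q.1 q.2.
Proof.
have [e|e] := boolP (odd (absz z)); rewrite /parity.
  by exists (true, ((z - 1) %/ 2)%Z) => /=; lia.
by exists (false, (z %/ 2)%Z) => /=; lia.
Qed.

Lemma twist_cellP o h d (p : 'I_d -> K) :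
  iwahori_double (wdiag K (parity o h)) (twist k (cell o h p)).
Proof. by apply: twist_cell => //; exact: val_ge_lpoly. Qed.

Lemma twist_cell_mulr o h d (p : 'I_d -> K) i : iwahori i ->
  iwahori_double (wdiag K (parity o h)) (twist k (cell o h p *m i)).
Proof.
by move=> Ii; apply: (twist_iwahori iota) (twist_cellP o h p) => //; exact: cell_unit.
Qed.

(** x lies in some cell, whose position is already known; distinct diagonal double cosets are
    disjoint, so it is the cell of (o, h). *)
Lemma cell_of_twist o h x : is_order (\det x) 0 ->
    iwahori_double (wdiag K (parity o h)) (twist k x) ->
  exists (p : 'I_(absz (parity o h)) -> K) i, iwahori i /\ x = cell o h p *m i.
Proof.
move=> /cell_exists[o' [h' [p [i [Ii ->]]]]] /iwahori_double_diag_inj.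
move/(_ _ (twist_cell_mulr o' h' p Ii)) => /parity_inj[oE hE]; subst o' h'.
by exists p, i.
Qed.

Lemma lcoset_mulr x i (A : set 'M[L]_2) : i \in unitmx ->
    (forall a, A a -> A (i *m a)) -> (forall a, A a -> A (invmx i *m a)) ->
  lcoset (x *m i) A = lcoset x A.
Proof.
move=> iu Ai AiV; apply/seteqP; split=> _ [a Aa <-].
  by exists (i *m a); [exact: Ai | rewrite mulmxA].
by exists (invmx i *m a); [exact: AiV | rewrite mulmxA mulmxK].
Qed.

Lemma lcoset_iwahori x i : iwahori i -> lcoset (x *m i) (@iwahori K) = lcoset x (@iwahori K).
Proof.
move=> Ii; apply: lcoset_mulr; first exact: iwahori_gl2.
  by move=> a; exact: iwahoriM.
by move=> a; apply/iwahoriM/iwahoriV.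
Qed.

Lemma lcoset_iwahori_sl x i : iwahori i -> sl2 i ->
  lcoset (x *m i) (@iwahori K `&` @sl2 K) = lcoset x (@iwahori K `&` @sl2 K).
Proof.
move=> Ii di; apply: lcoset_mulr; first exact: iwahori_gl2.
  move=> a [Ia da]; split; first exact: iwahoriM.
  by rewrite /sl2 /= det_mulmx di da mulr1.
move=> a [Ia da]; split; first by apply: iwahoriM => //; exact: iwahoriV.
by rewrite /sl2 /= det_mulmx det_inv di da invr1 mulr1.
Qed.

Lemma kcoprod_unit_kiso d :
  @is_kiso k K iota (kcoprod [set: unit] (affine_space K d)) (affine_space K d) snd.
Proof.
apply: (@kmorph_kiso k K iota (kcoprod [set: unit] (affine_space K d))
  (affine_space K d) snd (fun p : 'I_d -> K => (tt, p))) => //; last by move=> [[] p].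
- move=> [[] p] _; split=> // -[[] []] a /= [_ ap]; subst a.
  exists tt, 1, (fun v : 'I_d => kvar k v); split; first by rewrite rmorph1 oner_neq0.
  move=> [[] p'] a' _ /= [_ ->] _; apply/funext => v.
  by rewrite peval_kvar rmorph1 divr1.
- move=> p _; split=> // -[] a /= ap; subst a.
  exists (tt, tt), 1, (fun v : 'I_d => kvar k v); split; first by rewrite rmorph1 oner_neq0.
  move=> p' a' _ /= -> _; split=> //; apply/funext => v.
  by rewrite peval_kvar rmorph1 divr1.
Qed.

Lemma ADL_SL_affine o h :
  kisomorphic iota (flag_space (ADL_SL k (Wclass (wdiag K (parity o h))) (b1 K)))
    (affine_space K (absz (parity o h))).
Proof.
pose A := @iwahori K `&` @sl2 K; set d := absz (parity o h).
have AI : A `<=` @iwahori K by move=> a [].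
have A1 : A 1%:M by split; [exact: iwahori1 | rewrite /sl2 /= det1].
have [||j p _|j p _|j _|j _|j j' _ _ _|_ [g gi]] :=
  @flag_cells_kiso k K iota unit setT d (fun q => lcoset (cell o h q.2) A)
    (ADL_SL k (Wclass (wdiag K (parity o h))) (b1 K)) (fun=> uptype o h)
    (fun=> cell_exp o h + cell_shift false o h) (fun=> - cell_exp o h + cell_shift true o h)
    (fun=> cell_exp o h) (fun=> - cell_exp o h) _ _ _ _ _ _ _ tt.
- move=> j p _; apply/ADL_SL_twist; exists (cell o h p); split=> //.
    exact: det_cell.
  exact: twist_cellP.
- move=> c /ADL_SL_twist[x [dx -> xw]].
  have [|p [i [Ii xE]]] := cell_of_twist _ xw; first by rewrite dx; exact: is_order1.
  exists tt, p; split=> //; rewrite xE lcoset_iwahori_sl //.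
  by move: dx; rewrite /sl2 /= xE det_mulmx det_cell mul1r.
- by have [] := lat_cell o h p AI A1.
- by have [] := lat_cell o h p AI A1.
- by have [] := cell_shift_eq o h; lia.
- exact: cell_full.
- by case: j; case: j'.
by exists (snd \o g); exact: is_kiso_comp gi (kcoprod_unit_kiso d).
Qed.

End Assembly.

(** * The group J and its cosets modulo H *)

Section TwistedCentralizer.
Variables (k : finFieldType) (K : fieldType) (iota : {rmorphism k -> K}).
Local Notation sigma := (map_mx (frob k (K := K))).
Local Notation J := (Jgroup k (b1 K)).
Local Notation H := (Hgroup k (b1 K)).
Implicit Types (g x y : 'M[laurent K]_2).

Lemma JgroupE g : J g <-> g \in unitmx /\ b1 K *m sigma g = g *m b1 K.
Proof.
split=> -[gu E]; split=> //.
  by rewrite -[in RHS]E !mulmxA mulmxV // mul1mx.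
by rewrite -mulmxA E mulKmx.
Qed.

Lemma frob_mx1 : sigma 1%:M = 1%:M :> 'M_2.
Proof. by rewrite -mx2_1 map_mx2 frob0 frob1. Qed.

Lemma JgroupM g x : J g -> J x -> J (g *m x).
Proof.
move=> /JgroupE[gu gE] /JgroupE[xu xE]; apply/JgroupE; split.
  by rewrite unitmx_mul gu.
by rewrite (frob_mxM iota) mulmxA gE -!mulmxA xE.
Qed.

Lemma JgroupV g : J g -> J (invmx g).
Proof.
move=> /JgroupE[gu gE]; apply/JgroupE; rewrite unitmx_inv; split=> //.
have E : g *m (b1 K *m sigma (invmx g)) = b1 K.
  by rewrite mulmxA -gE -mulmxA -(frob_mxM iota) mulmxV // frob_mx1 mulmx1.
by rewrite -[LHS](mulKmx gu) E.
Qed.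

Lemma vL_detM g x : g \in unitmx -> x \in unitmx ->
  vL (\det (g *m x)) = vL (\det g) + vL (\det x).
Proof. by rewrite !unitmxE !unitfE det_mulmx; exact: vLM. Qed.

Lemma vL_detV g : g \in unitmx -> vL (\det (invmx g)) = - vL (\det g).
Proof.
move=> gu; have := vL_detM gu; move/(_ (invmx g)); rewrite unitmx_inv mulmxV // det1.
move=> /(_ gu); rewrite (vL_order (is_order1 K)) => /esym/eqP.
by rewrite addrC addr_eq0 => /eqP.
Qed.

Lemma Jgroup_unit g : J g -> g \in unitmx.
Proof. by case. Qed.

Lemma HgroupM x y : H x -> H y -> H (x *m y).
Proof.
move=> [Jx vx] [Jy vy]; split; first exact: JgroupM.
by rewrite vL_detM ?vx ?vy //; exact: Jgroup_unit.
Qed.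

Lemma HgroupV x : H x -> H (invmx x).
Proof.
move=> [Jx vx]; split; first exact: JgroupV.
by rewrite vL_detV ?vx //; exact: Jgroup_unit.
Qed.

Lemma lcoset_Hgroup g x : J g -> J x -> vL (\det g) = vL (\det x) ->
  lcoset g H = lcoset x H.
Proof.
move=> Jg Jx vE; have gu := Jgroup_unit Jg; have xu := Jgroup_unit Jx.
have Hgx : H (invmx g *m x).
  split; first by apply: JgroupM => //; exact: JgroupV.
  by rewrite vL_detM ?unitmx_inv // vL_detV // vE; lia.
rewrite -[x in RHS](mulKVmx gu); apply/esym/lcoset_mulr.
- exact: Jgroup_unit Hgx.1.
- by move=> a; exact: HgroupM.
- by move=> a Ha; apply: HgroupM => //; exact: HgroupV.
Qed.

Lemma lcoset_Hgroup_vL g x : J g -> J x -> lcoset g H = lcoset x H ->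
  vL (\det g) = vL (\det x).
Proof.
move=> Jg Jx E; have : lcoset x H g.
  rewrite -E; exists 1%:M; rewrite ?mulmx1 //.
  by split; [apply/JgroupE; rewrite unitmx1 frob_mx1 mulmx1 mul1mx
    | rewrite det1 (vL_order (is_order1 K))].
by move=> [y [Jy vy] <-]; rewrite vL_detM ?vy ?addr0 //; exact: Jgroup_unit.
Qed.

Lemma frob_scalar_mx z : sigma (t^z)%:M = (t^z)%:M :> 'M_2.
Proof.
have E : mx2 (t^z) 0 0 (t^z) = (t^z)%:M :> 'M[laurent K]_2.
  by rewrite [RHS]mx2E !mxE.
by rewrite -E map_mx2 frob0 frob_mono.
Qed.

Lemma gshift_Jgroup (o : bool) z : J (gshift K o z).
Proof.
apply/JgroupE; rewrite gshift_unit; split=> //.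
rewrite /gshift (frob_mxM iota) frob_scalar_mx.
have C : b1 K *m (t^z)%:M = (t^z)%:M *m b1 K by rewrite scalar_mxC.
rewrite mulmxA C -2!mulmxA; congr (_ *m _).
by case: o; rewrite ?frob_mx1 ?mulmx1 ?mul1mx // /b1 map_mx2 frob_mono frob0 frob1.
Qed.

End TwistedCentralizer.

(** * The components for GL_2 and their permutation by J *)

Section Coproduct.
Variables (k : finFieldType) (K : fieldType) (iota : {rmorphism k -> K}).
Local Notation J := (Jgroup k (b1 K)).
Local Notation H := (Hgroup k (b1 K)).
Local Notation JH := (JmodH k (b1 K)).
Implicit Types (g x y : 'M[laurent K]_2) (j : set 'M[laurent K]_2).

Lemma twist_gshift n (o : bool) z x : x \in unitmx ->
  iwahori_double n (twist k x) <-> iwahori_double n (twist k (gshift K o z *m x)).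
Proof. by move=> xu; rewrite (twist_Jgroup iota) //; exact: gshift_Jgroup. Qed.

(** A power of b1 lies in J and brings the determinant to order 0 without changing the position;
    there every point lies in a cell and has a diagonal position. *)
Lemma ADL_GL_wanti s : ~ (ADL_GL k (Wclass (wanti K s)) (b1 K) !=set0).
Proof.
move=> [c /ADL_GL_twist[x [xu _ xw]]].
have [[o z] /= oz] := parity_surj (vL (\det x)).
have gu := gshift_unit K o z; pose y := invmx (gshift K o z) *m x.
have yu : y \in unitmx by rewrite unitmx_mul unitmx_inv gu.
have xE : x = gshift K o z *m y := esym (mulKVmx gu x).
have dy : is_order (\det y) 0.
  have dx : is_order (\det x) (vL (\det x)) by apply/is_order_vL; move/gl2E: xu.
  rewrite det_mulmx det_inv; apply: (is_orderM_eq (is_orderV (det_gshift K o z)) dx).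
  by rewrite oz addNr.
have [o' [h [p [i [Ii yE]]]]] := cell_exists dy.
rewrite xE in xw; have := (twist_gshift _ o z yu).2 xw; rewrite yE.
exact: iwahori_double_diag_anti (twist_cell_mulr iota o' h p Ii).
Qed.

Lemma JmodH_rank : exists r : set 'M[laurent K]_2 -> int,
  forall g, J g -> r (lcoset g H) = vL (\det g).
Proof.
have /choice[rep repP] : forall j, exists g, JH j -> J g /\ lcoset g H = j.
  move=> j; have [[g Jg <-]|nj] := pselect (JH j); first by exists g.
  by exists 1%:M => /nj.
exists (fun j => vL (\det (rep j))) => g Jg.
have [Jr rE] := repP (lcoset g H) (ex_intro2 _ _ g Jg erefl).
exact: (lcoset_Hgroup_vL Jr Jg rE).
Qed.

Lemma shifted_cell (a : bool) z (o : bool) h d (p : 'I_d -> K) :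
  [/\ gshift K a z *m cell o h p \in unitmx,
      is_order (\det (gshift K a z *m cell o h p)) (parity a z)
    & iwahori_double (wdiag K (parity o h)) (twist k (gshift K a z *m cell o h p))].
Proof.
have cu := @cell_unit K o h d p; split.
- by rewrite unitmx_mul gshift_unit.
- by rewrite det_mulmx (det_cell o h p) mulr1; exact: det_gshift.
- exact: (twist_gshift _ a z cu).1 (twist_cellP iota o h p).
Qed.

Lemma ADL_GL_coproduct (o : bool) h :
  let d := absz (parity o h) in
  let X := flag_space (ADL_GL k (Wclass (wdiag K (parity o h))) (b1 K)) in
  exists f : kpt (kcoprod JH (affine_space K d)) -> kpt X,
    is_kiso iota f /\
    forall g j, J g -> JH j ->
      [set lcoset g c | c in f @` kcomponent JH (affine_space K d) j] =
      f @` kcomponent JH (affine_space K d) (lcoset g j).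
Proof.
move=> d X; have [r rE] := JmodH_rank.
have /choice[q qE] := parity_surj.
(* The coset j is represented by the power of b1 with exponent r j, for which the translated
   lattices are explicit. *)
pose gj j := gshift K (q (r j)).1 (q (r j)).2.
have gju j : gj j \in unitmx by exact: gshift_unit.
pose x_ (jp : set 'M[laurent K]_2 * ('I_d -> K)) := gj jp.1 *m cell o h jp.2.
have xP (jp : set 'M[laurent K]_2 * ('I_d -> K)) :=
  shifted_cell (q (r jp.1)).1 (q (r jp.1)).2 o h jp.2.
have xu jp : x_ jp \in unitmx by case: (xP jp).
have dx jp : is_order (\det (x_ jp)) (r jp.1).
  by case: (xP jp) => _ + _; rewrite -qE.
have xw jp : iwahori_double (wdiag K (parity o h)) (twist k (x_ jp)).
  by case: (xP jp).
pose f jp := lcoset (x_ jp) (@iwahori K).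
(* Valuation of the determinant and position alone decide membership in component j. This gives
   surjectivity onto X_w(b1) as well as the action of J. *)
have fE j x : x \in unitmx -> iwahori_double (wdiag K (parity o h)) (twist k x) ->
    vL (\det x) = r j -> exists p, lcoset x (@iwahori K) = f (j, p).
  move=> xu' xw' vx; pose y := invmx (gj j) *m x.
  have yu : y \in unitmx by rewrite unitmx_mul unitmx_inv gju.
  have xE : x = gj j *m y := esym (mulKVmx (gju j) x).
  have dy : is_order (\det y) 0.
    have dx' : is_order (\det x) (vL (\det x)) by apply/is_order_vL/gl2E.
    rewrite det_mulmx det_inv.
    apply: (is_orderM_eq (is_orderV (det_gshift K (q (r j)).1 (q (r j)).2)) dx').
    by rewrite vx -qE addNr.
  have [|p [i [Ii yE]]] := @cell_of_twist k K iota o h y dy.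
    by apply/(twist_gshift _ (q (r j)).1 (q (r j)).2 yu); rewrite -/(gj j) -xE.
  by exists p; rewrite xE yE mulmxA lcoset_iwahori.
have JHr j j' : JH j -> JH j' -> r j = r j' -> j = j'.
  move=> [g Jg <-] [g' Jg' <-]; rewrite !rE //; exact: lcoset_Hgroup.
have JHM g j : J g -> JH j -> JH (lcoset g j) /\ r (lcoset g j) = vL (\det g) + r j.
  move=> Jg [g' Jg' <-].
  have -> : lcoset g (lcoset g' H) = lcoset (g *m g') H.
    apply/seteqP; split=> [_ [_ [a Ha <-] <-]|_ [a Ha <-]].
      by exists a; rewrite ?mulmxA.
    by exists (g' *m a); [exists a | rewrite mulmxA].
  have Jgg' := JgroupM iota Jg Jg'; split; first by exists (g *m g').
  by rewrite (rE _ Jgg') (rE _ Jg') (vL_detM (Jgroup_unit Jg) (Jgroup_unit Jg')).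
have fJ g j p : J g -> JH j -> exists p', lcoset g (f (j, p)) = f (lcoset g j, p').
  move=> Jg Jj; have gu := Jgroup_unit Jg; have [_ rgj] := JHM g j Jg Jj.
  have -> : lcoset g (f (j, p)) = lcoset (g *m x_ (j, p)) (@iwahori K).
    apply/seteqP; split=> [_ [_ [a Ha <-] <-]|_ [a Ha <-]].
      by exists a; rewrite ?mulmxA.
    by exists (x_ (j, p) *m a); [exists a | rewrite mulmxA].
  apply: fE; first by rewrite unitmx_mul gu xu.
    by rewrite (twist_Jgroup iota).
  by rewrite vL_detM // rgj (vL_order (dx _)).
exists f; split.
  have [|||||||f1 _] := @flag_cells_kiso k K iota _ JH d f
    (ADL_GL k (Wclass (wdiag K (parity o h))) (b1 K))
    (fun j => (q (r j)).1 (+) uptype o h)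
    (fun j => cell_exp o h + cell_shift false o h + (q (r j)).2 +
              (if (q (r j)).1 then eps (uptype o h) else 0))
    (fun j => - cell_exp o h + cell_shift true o h + (q (r j)).2 +
              (if (q (r j)).1 then 1 - eps (uptype o h) else 0))
    (fun j => cell_exp o h + (q (r j)).2 +
              (if (q (r j)).1 then eps (uptype o h) else 0))
    (fun j => - cell_exp o h + (q (r j)).2 +
              (if (q (r j)).1 then 1 - eps (uptype o h) else 0))
    _ _ _ _ _ _ _ set0.
  - by move=> j p _; apply/ADL_GL_twist; exists (x_ (j, p)); split=> //; exact: xu.
  - move=> c /ADL_GL_twist[x [xu' -> xw']].
    have [[o' z] /= oz] := parity_surj (vL (\det x)).
    have Jg := gshift_Jgroup iota o' z.
    have [|p ->] := @fE (lcoset (gshift K o' z) H) x xu' xw'.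
      by rewrite rE // (vL_order (det_gshift K o' z)).
    by exists (lcoset (gshift K o' z) H), p; split=> //; exists (gshift K o' z).
  - move=> j p _; apply: lat_gshift; first exact: cell_unit.
    by have [] := lat_cell o h p (@subset_refl _ _) (iwahori1 K).
  - move=> j p _; apply: lat_gshift; first exact: cell_unit.
    by have [] := lat_cell o h p (@subset_refl _ _) (iwahori1 K).
  - by move=> j _; have [] := cell_shift_eq o h; lia.
  (* When b1 flips the type, n - m grows by 1 - 2 eps, which is exactly the change of eps. *)
  - move=> j _; have := cell_full o h; rewrite -/d.
    by case: (q (r j)).1; rewrite /eps; case: (uptype o h) => /=; lia.
  (* The sum of the two exponents of the smaller lattice is 1 + r j: the contributions of [cell_exp]
     cancel and the shifts add up to 1. *)
  - move=> j j' Jj Jj' e; apply: JHr => //; rewrite [r j]qE [r j']qE /parity.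
    by move: e; case: (q (r j)).1; case: (q (r j')).1 => /=; lia.
  - exact: f1.
move=> g j Jg Jj; apply/seteqP; split.
  move=> _ [_ [[j' p] [/= jE _] <-] <-]; subst j'.
  by have [p' ->] := fJ g j p Jg Jj; exists (lcoset g j, p').
move=> _ [[j' p] [/= jE _] <-]; subst j'.
have [JHgj rgj] := JHM g j Jg Jj; have JV := JgroupV iota Jg.
have gu := Jgroup_unit Jg.
(* The reverse inclusion is the forward one for g^-1, applied to the component of g j and translated
   back by g. *)
have [p' E] := fJ (invmx g) (lcoset g j) p JV JHgj.
have gjE : lcoset (invmx g) (lcoset g j) = j.
  apply/seteqP; split=> [_ [_ [a Ha <-] <-]|a Ha].
    by rewrite (mulKmx gu).
  exists (g *m a); first by exists a.
  by rewrite (mulKmx gu).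
rewrite gjE in E; exists (f (j, p')); first by exists (j, p').
rewrite -E; apply/seteqP; split=> [_ [_ [a Ha <-] <-]|a Ha].
  by rewrite (mulKVmx gu).
exists (invmx g *m a); first by exists a.
by rewrite (mulKVmx gu).
Qed.

End Coproduct.

Theorem proposition4p15 (k : finFieldType) (K : closedFieldType)
    (iota : {rmorphism k -> K}) (K_alg : forall x : K, algebraicOver iota x)
    (w : set 'M[laurent K]_2) (hw : Wa K w)
    (X_neq0 : ADL_GL k w (b1 K) !=set0) :
  let d := (wlength w)./2 in
  let A := affine_space K d in
  let X := flag_space (ADL_GL k w (b1 K)) in
  let JH := JmodH k (b1 K) in
  kisomorphic iota (flag_space (ADL_SL k w (b1 K))) A /\
  exists f : kpt (kcoprod JH A) -> kpt X,
    is_kiso iota f /\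
    forall g j, Jgroup k (b1 K) g -> JH j ->
      [set lcoset g c | c in f @` kcomponent JH A j] =
      f @` kcomponent JH A (lcoset g j).
Proof.
have [s [wE|wE]] := Wa_cases hw; last by rewrite wE in X_neq0; case: (ADL_GL_wanti iota X_neq0).
have [[o h] /= sE] := parity_surj s; rewrite {}sE in wE.
rewrite {}wE; have -> : (wlength (Wclass (wdiag K (parity o h))))./2 = absz (parity o h).
  by rewrite wlength_wdiag; lia.
by split; [exact: ADL_SL_affine | exact: ADL_GL_coproduct].
Qed.
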